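(* Let $\boldsymbol{R}=(R_1,\ldots,R_m)$ be a system of $m\ge2$ rational functions in $\mathbb{Q}(X_1,\ldots,X_m)$ of degree at most $d\ge2$ and height at most $h$. Let $V\subset\mathbb{A}^m_{\mathbb{Q}}$ be the affine variety defined by $P_1,\ldots,P_s\in\mathbb{Z}[X_1,\ldots,X_m]$ of degree at most $D$ and height at most $H$. Assume the intersection of the orbits of $\boldsymbol{R}$ with $V$ is $L$-uniformly bounded. Then there is a constant $c>0$ depending only on $(d,D,h,H,L,m,s)$ such that for every real $\varepsilon>0$ there exists $\mathfrak{B}\in\mathbb{N}$ with $\log\mathfrak{B}\le\exp(c/\varepsilon)$ such that, for every prime $p$ not dividing $\mathfrak{B}$, every integer $N\ge 2L/\varepsilon+1$ and every $\boldsymbol{w}\in\overline{\mathbb{F}}_p^{\,m}$ with $T(\boldsymbol{w})\ge N$, $$\frac{\#\mathfrak{V}_{\boldsymbol{w}}(\boldsymbol{R},V;p,N)}{N}\le\varepsilon.$$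
   Context: Degree and height of a rational function $R=F/G$ (coprime $F,G\in\mathbb{Z}[X]$) are $\max\{\deg F,\deg G\}$ and $\max\{\mathrm{h}(F),\mathrm{h}(G)\}$, with $\mathrm{h}$ the log of the maximal absolute value of coefficients. Iterates: $R_i^{(0)}=X_i$, $R_i^{(n)}=R_i(R_1^{(n-1)},\ldots,R_m^{(n-1)})$; write $R_i^{(n)}=F_{i,n}/G_{i,n}$ coprime. For a system over a field $K$ and $\boldsymbol{w}\in\overline{K}^m$, the orbit is $\boldsymbol{w}_0=\boldsymbol{w}$, $\boldsymbol{w}_n=\boldsymbol{R}(\boldsymbol{w}_{n-1})$, terminating when $\boldsymbol{w}_{n-1}$ is a pole. The intersection of orbits of $\boldsymbol{R}$ with $V$ is $L$-uniformly bounded if for all $\boldsymbol{w}\in\overline{\mathbb{Q}}^m$, $\#\{n\in\mathbb{N}:\boldsymbol{w}_n\in V(\overline{\mathbb{Q}})\}\le L$. For a prime $p$, $\boldsymbol{R}_p^{(n)}$ and $V_p$ are the reductions modulo $p$ of $\boldsymbol{R}^{(n)}$ (reducing $F_{i,n},G_{i,n}$) and of $V$ (reducing the $P_j$). For $\boldsymbol{w}\in\overline{\mathbb{F}}_p^{\,m}$, $\mathfrak{V}_{\boldsymbol{w}}(\boldsymbol{R},V;p,N)$ is the set of $n\in\{0,\ldots,N-1\}$ with $\boldsymbol{R}_p^{(n)}(\boldsymbol{w})$ defined and in $V_p(\overline{\mathbb{F}}_p)$, and $T(\boldsymbol{w})\in\mathbb{N}\cup\{\infty\}$ is the number of distinct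 points $\boldsymbol{w}_n$, $n\ge1$, in the orbit of $\boldsymbol{w}$ under the reduced system $\boldsymbol{R}_p$. *)

(* Defs.v *)
From HB Require Import structures.
From mathcomp Require Import all_boot all_order all_algebra all_field.
From mathcomp Require Import mpoly.
From mathcomp Require Import boolp classical_sets functions cardinality reals.
(* Required without Import: the notations of these two files clash with those
   of mpoly. *)
From mathcomp Require sequences exp.

Set Implicit Arguments.
Unset Strict Implicit.
Unset Printing Implicit Defensive.

Import Order.TTheory GRing.Theory Num.Theory.
Local Open Scope ring_scope.

Notation expR := (@sequences.expR _).
Notation ln := (@exp.ln _).

(* An algebraic closure of 'F_p, for p prime. *)
Definition Fpbar (p : nat) : closedFieldType :=
  projT1 (countable_algebraic_closure 'F_p).

Definition ratfun (m : nat) := {fraction {mpoly rat[m]}}.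

Definition ZtoQX m (F : {mpoly int[m]}) : ratfun m :=
  FracField.tofrac (map_mpoly (intr : int -> rat) F).

(* Value of F at a point of K^m. For K of characteristic p this is the value of
   the reduction of F modulo p; for K = ratfun m it is substitution. *)
Definition zeval (K : fieldType) m (F : {mpoly int[m]}) (w : 'I_m -> K) : K :=
  (map_mpoly (intr : int -> K) F).@[w].

(* Coprimality in Z[X_1, ..., X_m]: in particular the integer contents are
   coprime too. *)
Definition coprime_mpoly m (F G : {mpoly int[m]}) : Prop :=
  forall A B C : {mpoly int[m]},
    F = A * B -> G = A * C -> A \is a GRing.unit.

Definition is_reduced_form m (r : ratfun m)
    (FG : {mpoly int[m]} * {mpoly int[m]}) : Prop :=
  [/\ FG.2 != 0, coprime_mpoly FG.1 FG.2 & r = ZtoQX FG.1 / ZtoQX FG.2].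

Lemma fraction_numden (D : idomainType) (x : {fraction D}) :
  exists a b : D,
    b != 0 /\ x = FracField.tofrac a / FracField.tofrac b.
Proof.
elim/quotW: x => x; exists (frac x).1, (frac x).2; split; first exact: denom_ratioP.
have nz : FracField.tofrac (frac x).2 != 0 by rewrite tofrac_eq0 denom_ratioP.
apply: (mulIf nz); rewrite mulfVK //.
unlock FracField.tofrac; rewrite -[LHS]FracField.pi_mul.
rewrite /FracField.mulf /=; apply/eqmodP => /=.
rewrite FracField.equivfE !numden_Ratio ?oner_neq0 ?mulf_neq0 ?denom_ratioP //.
- by rewrite !mulr1 mulrC.
all: exact: oner_neq0.
Qed.

Lemma clear_denominators m (P : {mpoly rat[m]}) :
  exists (c : int) (F : {mpoly int[m]}),
    c != 0 /\ c%:~R *: P = map_mpoly (intr : int -> rat) F.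
Proof.
elim/mpolyind: P => [|a k P _ _ [c [F [nzc eF]]]].
  by exists 1, 0; split=> //; rewrite scaler0 rmorph0.
exists (denq a * c), ((numq a * c) *: 'X_[k] + denq a *: F); split.
  by rewrite mulf_neq0 ?denq_neq0.
rewrite rmorphD /= !map_mpolyZ -eF map_mpolyX scalerDr !scalerA !rmorphM /=.
congr (_ *: _ + _); rewrite mulrAC; congr (_ * _).
by rewrite -{2}[a]divq_num_den mulrC divfK // intr_eq0 denq_neq0.
Qed.

Lemma exists_reduced_form m (r : ratfun m) : exists FG, is_reduced_form r FG.
Proof.
have nzmap (F : {mpoly int[m]}) : F != 0 -> ZtoQX F != 0.
  move=> nzF; rewrite /ZtoQX tofrac_eq0; apply: contraNneq nzF => F0.
  apply/eqP/mpolyP => k; move/mpolyP/(_ k): F0.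
  by rewrite mcoeff_map_mpoly !mcoeff0 => /eqP; rewrite intr_eq0 => /eqP.
have ZtoQXM (F G : {mpoly int[m]}) : ZtoQX (F * G) = ZtoQX F * ZtoQX G.
  by rewrite /ZtoQX !rmorphM.
have [F [G [nzG ->]]] : exists F G : {mpoly int[m]},
    G != 0 /\ r = ZtoQX F / ZtoQX G.
  have [a [b [nzb ->]]] := fraction_numden r.
  have [c [F [nzc eF]]] := clear_denominators a.
  have [d [G [nzd eG]]] := clear_denominators b.
  exists (d *: F), (c *: G); split.
    rewrite -mul_mpolyC mulf_neq0 ?mpolyC_eq0 //.
    apply: contraNneq nzb => G0; move: eG.
    rewrite G0 rmorph0 => /eqP; rewrite mscalerI intr_eq0.
    by rewrite (negPf nzd).
  rewrite /ZtoQX !map_mpolyZ -eF -eG !scalerA /= [_%:~R * _]mulrC.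
  rewrite -!mul_mpolyC !tofracM -mulf_div divff ?mul1r //.
  by rewrite tofrac_eq0 mpolyC_eq0 mulf_neq0 ?intr_eq0.
have [n leGn] := ubnP (msize G + `|mleadc G|)%N.
elim: n F G nzG leGn => // n IHn F G nzG leGn.
have [copFG | ] := pselect (coprime_mpoly F G); first by exists (F, G).
move=> /existsNP[A /existsNP[B /existsNP[C]]].
move=> /not_implyP[eF /not_implyP[eG /negP nuA]].
have nzA : A != 0 by apply: contraNneq nzG => A0; rewrite eG A0 mul0r.
have nzC : C != 0 by apply: contraNneq nzG => C0; rewrite eG C0 mulr0.
have -> : ZtoQX F / ZtoQX G = ZtoQX B / ZtoQX C.
  by rewrite eF eG !ZtoQXM -mulf_div divff ?mul1r ?nzmap.
apply: IHn => //; rewrite ltnS in leGn; apply: leq_trans leGn.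
rewrite eG mleadcM_proper ?mulf_neq0 ?mleadc_eq0 // abszM msizeM //.
have lA : (0 < `|mleadc A|)%N by rewrite absz_gt0 mleadc_eq0.
have lC : (0 < `|mleadc C|)%N by rewrite absz_gt0 mleadc_eq0.
have sA : (0 < msize A)%N by rewrite lt0n msize_poly_eq0.
have [sA1 | ] := leqP (msize A) 1; last first.
  move=> sA1; apply: (@leq_trans (msize C + `|mleadc C|).+1) => //.
  rewrite -addSn leq_add // ?leq_pmull //.
  by case: (msize A) sA1 => [|[|k]] // _; rewrite addSn /= addSn ltnS leq_addl.
have eA := msize1_polyC sA1.
have lcA : mleadc A = A@_0 by rewrite eA mleadcC mcoeffC eqxx mulr1.
have {sA} -> : msize A = 1%N by apply/eqP; rewrite eqn_leq sA1 sA.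
rewrite add1n /= ltn_add2l -{1}[`|mleadc C|%N]mul1n ltn_mul2r lC /=.
rewrite ltn_neqAle lA andbT eq_sym; apply/eqP => lA1.
move/negP: nuA; apply; rewrite eA.
by apply: (rmorph_unit (@mpolyC m int)); rewrite -lcA; case: (mleadc A) lA1 => [[|[|]]|[|]].
Qed.

(* The reduced form is unique up to a common sign, on which none of the notions
   below depends. *)
Definition reduced_form m (r : ratfun m) := sval (cid (exists_reduced_form r)).
Definition numer m (r : ratfun m) : {mpoly int[m]} := (reduced_form r).1.
Definition denom m (r : ratfun m) : {mpoly int[m]} := (reduced_form r).2.

(* msize is the total degree plus one, and 0 for the zero polynomial. *)
Definition mdegree m (F : {mpoly int[m]}) : nat := (msize F).-1.

(* The zero polynomial has height 0, since ln 0 = 0. *)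
Definition mheight (R : realType) m (F : {mpoly int[m]}) : R :=
  ln (\max_(k <- msupp F) `|F@_k|%N)%:R.

Definition ratdegree m (r : ratfun m) : nat :=
  maxn (mdegree (numer r)) (mdegree (denom r)).

Definition ratheight (R : realType) m (r : ratfun m) : R :=
  Num.max (mheight R (numer r)) (mheight R (denom r)).

Definition ratsystem (m : nat) := 'I_m -> ratfun m.

Section Evaluation.
Variables (K : fieldType) (m : nat).
Implicit Types (S : ratsystem m).

(* These are the poles and values of the system itself over an extension K of
   the rationals, and of its reduction modulo p if K has characteristic p. *)
Definition is_pole S (w : 'I_m -> K) : bool :=
  [exists i, zeval (denom (S i)) w == 0].

(* Meaningful only when w is not a pole of S. *)
Definition sysval S (w : 'I_m -> K) : {ffun 'I_m -> K} :=
  [ffun i => zeval (numer (S i)) w / zeval (denom (S i)) w].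

(* orbit_at S w n is the point w_n, or None if the orbit terminates earlier. *)
Fixpoint orbit_at S (w : {ffun 'I_m -> K}) (n : nat) : option {ffun 'I_m -> K} :=
  if n is k.+1 then
    if orbit_at S w k is Some v then
      if is_pole S v then None else Some (sysval S v)
    else None
  else Some w.

Definition on_variety s (P : 'I_s -> {mpoly int[m]}) (w : 'I_m -> K) : bool :=
  [forall j, zeval (P j) w == 0].

(* T(w) is the cardinality of this set. *)
Definition orbit_points S (w : {ffun 'I_m -> K}) : set {ffun 'I_m -> K} :=
  [set v | exists2 n, (0 < n)%N & orbit_at S w n = Some v]%classic.

End Evaluation.

Definition uniformly_bounded m s (S : ratsystem m)
    (P : 'I_s -> {mpoly int[m]}) (L : nat) : Prop :=
  forall w : {ffun 'I_m -> algC},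
    ([set n | exists2 v, orbit_at S w n = Some v & on_variety P v]%classic
       #<= (`I_L)%classic)%card.

(* iterate S n is meaningful only when iterate_defined S n holds: the composition
   R_i(T) is undefined if T is a pole of R_i. *)
Fixpoint iterate m (S : ratsystem m) (n : nat) : ratsystem m :=
  if n is k.+1 then sysval S (iterate S k)
  else fun i => ZtoQX 'X_i.

Definition iterate_defined m (S : ratsystem m) (n : nat) : bool :=
  [forall k : 'I_n, ~~ is_pole S (iterate S k)].

Definition visits (K : fieldType) m s (S : ratsystem m)
    (P : 'I_s -> {mpoly int[m]}) (N : nat) (w : 'I_m -> K) : {set 'I_N} :=
  [set n : 'I_N | [&& iterate_defined S n, ~~ is_pole (iterate S n) w
                    & on_variety P (sysval (iterate S n) w)]].

(* Main.v *)
(* If a point w has more than eps N visits to V at times below N, then some window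
   of length K ~ 2L/eps contains more than L of them. Take u to be the orbit point
   at the beginning of that window and sigma the set of visiting times: u solves
   the system "P_j(R^(n)(u)) = 0 for n in sigma, and no pole is met". The system
   has no solution in characteristic 0, so by an arithmetic Nullstellensatz it has
   none modulo p, unless p divides an integer B_sigma. Since the iterates have
   degree and logarithmic height exponential in K and the number m + 1 of variables
   is fixed, log B_sigma is exponential in 1/eps as soon as the Nullstellensatz
   bound is polynomial for each fixed number of variables; so is the logarithm of
   the product of the B_sigma over the 2^K sets sigma.

   Such a bound follows by eliminating one variable at a time. After a Kronecker
   type change of coordinates one equation f has a constant leading coefficient in
   the variable Y to be eliminated; the resultants in Y of f and of the integer
   specializations, u = 0, 1, 2, ..., of the pencil f_0 + u f_1 + u^2 f_2 + ...
   then have a common zero in characteristic 0 only if all the f_i do, whereas in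
   any characteristic a common zero of the f_i yields one of the resultants. *)

Require Import Defs.
From mathcomp Require Import all_boot all_order all_fingroup all_algebra all_field.
From mathcomp Require Import mpoly.
From mathcomp Require Import boolp classical_sets functions cardinality reals.
From mathcomp Require Import zify ring lra.
From mathcomp Require exp.

Set Implicit Arguments.
Unset Strict Implicit.
Unset Printing Implicit Defensive.

Import Order.TTheory GRing.Theory Num.Theory.
Local Open Scope ring_scope.

(** * Iterated polynomials over the integers: degree and l1 norm *)

(** Nesting turns elimination into an induction on [n]: the variable to be eliminated is kept
    outermost, where univariate resultants apply. *)
Fixpoint itpoly (n : nat) : idomainType :=
  if n is k.+1 then ({poly (itpoly k)} : idomainType) else (int : idomainType).

Fixpoint ieval (T : comNzRingType) (w : nat -> T) (n : nat) :
    {rmorphism itpoly n -> T} :=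
  match n return {rmorphism itpoly n -> T} with
  | 0 => (intmul 1 : {rmorphism int -> T})
  | k.+1 => (horner_eval (w k) \o map_poly (ieval w k) : {rmorphism {poly (itpoly k)} -> T})
  end.

(* Junk value 0 when n <= i. *)
Fixpoint ivar (n i : nat) : itpoly n :=
  match n return itpoly n with
  | 0 => (0 : int)
  | k.+1 => if i == k then ('X : {poly (itpoly k)}) else (ivar k i)%:P
  end.

Fixpoint l1norm (n : nat) : itpoly n -> nat :=
  match n return itpoly n -> nat with
  | 0 => fun c : int => `|c|%N
  | k.+1 => fun f : {poly (itpoly k)} => (\sum_(i < size f) l1norm f`_i)%N
  end.

Fixpoint degle (a n : nat) : itpoly n -> Prop :=
  match n return itpoly n -> Prop with
  | 0 => fun _ => True
  | k.+1 => fun f : {poly (itpoly k)} => (size f <= a.+1)%N /\ forall i, degle a f`_i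
  end.

(** One parameter bounds the degree in each variable and the binary logarithm of the l1 norm. Both
    bounds add up under products, so a single number is tracked through the elimination. *)
Definition bounded n (a : nat) (f : itpoly n) := degle a f /\ (l1norm f <= 2 ^ a)%N.

Lemma ievalS (T : comNzRingType) (w : nat -> T) n (f : {poly (itpoly n)}) :
  ieval w n.+1 f = (map_poly (ieval w n) f).[w n].
Proof. by []. Qed.

Lemma rmorph_ieval (A B : comNzRingType) (g : {rmorphism A -> B}) (w : nat -> A) n
    (f : itpoly n) : g (ieval w n f) = ieval (g \o w) n f.
Proof.
elim: n f => [|n IHn] f; first exact: rmorph_int.
rewrite !ievalS -horner_map -map_poly_comp; congr (_.[_]).
by apply: eq_map_poly => c /=; rewrite IHn.
Qed.

Lemma eq_ieval (T : comNzRingType) (v w : nat -> T) n (f : itpoly n) :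
  (forall i, (i < n)%N -> v i = w i) -> ieval v n f = ieval w n f.
Proof.
elim: n f => [|n IHn] f vw //.
rewrite !ievalS vw //; congr (_.[_]).
by apply: eq_map_poly => c; apply: IHn => i ltin; apply: vw; apply: leqW.
Qed.

Lemma ieval_var (T : comNzRingType) (w : nat -> T) n i :
  (i < n)%N -> ieval w n (ivar n i) = w i.
Proof.
elim: n => // n IHn ltin; rewrite ievalS [ivar _ _]/=.
have [->|neq] := eqVneq; first by rewrite map_polyX hornerX.
by rewrite map_polyC hornerC /= IHn // ltn_neqAle neq -ltnS.
Qed.

Lemma l1norm0 n : l1norm (0 : itpoly n) = 0%N.
Proof. by case: n => //= n; rewrite size_poly0 big_ord0. Qed.

Lemma l1norm_widen n N (f : {poly (itpoly n)}) : (size f <= N)%N ->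
  l1norm (f : itpoly n.+1) = (\sum_(i < N) l1norm f`_i)%N.
Proof.
move=> leN /=; rewrite (big_ord_widen _ (fun i => l1norm f`_i) leN) big_mkcond.
apply: eq_bigr => i _; case: ltnP => // lei.
by rewrite nth_default // l1norm0.
Qed.

Lemma l1normD n (f g : itpoly n) : (l1norm (f + g)%R <= l1norm f + l1norm g)%N.
Proof.
elim: n f g => [|n IHn] f g; first by rewrite -lez_nat PoszD !abszE ler_normD.
pose N := maxn (size (f : {poly (itpoly n)})) (size (g : {poly (itpoly n)})).
rewrite (@l1norm_widen _ N); last exact: size_polyD.
rewrite (@l1norm_widen _ N f) ?leq_maxl // (@l1norm_widen _ N g) ?leq_maxr //.
by rewrite -big_split leq_sum // => i _; rewrite coefD.
Qed.

Lemma l1norm_sum n I (r : seq I) (F : I -> itpoly n) :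
  (l1norm (\sum_(i <- r) F i)%R <= \sum_(i <- r) l1norm (F i))%N.
Proof.
elim/big_rec2: _ => [|i y x _ IH]; first by rewrite l1norm0.
by apply: leq_trans (l1normD _ _) _; rewrite leq_add2l.
Qed.

Lemma l1normC n (c : itpoly n) : l1norm (c%:P : itpoly n.+1) = l1norm c.
Proof. by rewrite (@l1norm_widen _ 1) ?size_polyC ?leq_b1 // big_ord1 coefC. Qed.

Lemma l1normXM n j (f : {poly (itpoly n)}) :
  @l1norm n.+1 ('X^j * f : {poly (itpoly n)}) = @l1norm n.+1 f.
Proof.
have le : (size ('X^j * f)%R <= j + size f)%N.
  have [->|nzf] := eqVneq f 0; first by rewrite mulr0 size_poly0.
  by rewrite mulrC size_mulXn.
rewrite (l1norm_widen le) big_split_ord /= big1 ?add0n => [|i _].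
  by apply: eq_bigr => i _; rewrite coefXnM ltnNge leq_addr /= addKn.
by rewrite coefXnM ltn_ord l1norm0.
Qed.

Lemma l1normM n (f g : itpoly n) : (l1norm (f * g)%R <= l1norm f * l1norm g)%N.
Proof.
elim: n f g => [|n IHn] f g; first by rewrite /= abszM.
have l1normZ (c : itpoly n) (h : {poly (itpoly n)}) :
    (@l1norm n.+1 (c *: h)%R <= l1norm c * l1norm (h : itpoly n.+1))%N.
  rewrite (l1norm_widen (size_scale_leq c h)) big_distrr leq_sum //= => i _.
  by rewrite coefZ.
rewrite -[X in (X * _)%R](coefK (f : {poly (itpoly n)})) poly_def mulr_suml.
apply: leq_trans (l1norm_sum _ _) _; rewrite big_distrl leq_sum //= => i _.
rewrite -scalerAl; apply: leq_trans (l1normZ _ _) _.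
by rewrite leq_mul2l l1normXM leqnn orbT.
Qed.

Lemma l1norm_nat n k : (l1norm (k%:R : itpoly n) <= k)%N.
Proof.
elim: n => [|n IHn]; first by rewrite /= natz.
by rewrite -[_%:R](@polyC_natr (itpoly n)) l1normC.
Qed.

Lemma l1norm_int n (z : int) : (l1norm (z%:~R : itpoly n) <= `|z|)%N.
Proof.
elim: n => [|n IHn]; first by rewrite /= intz.
have := l1normC (z%:~R : itpoly n).
by rewrite (rmorph_int (@polyC (itpoly n))) => ->.
Qed.

Lemma degle0 n a : @degle a n 0.
Proof. by elim: n => //= n IHn; split=> [|i]; rewrite ?size_poly0 ?coef0. Qed.

Lemma degleW n a b (f : itpoly n) : (a <= b)%N -> degle a f -> degle b f.
Proof.
move=> leab; elim: n f => //= n IHn f [sf cf]; split=> [|i]; last exact: IHn.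
exact: leq_trans sf _.
Qed.

Lemma degleD n a (f g : itpoly n) : degle a f -> degle a g -> degle a (f + g).
Proof.
elim: n f g => //= n IHn f g [sf cf] [sg cg]; split=> [|i].
  by apply: leq_trans (size_polyD _ _) _; rewrite geq_max sf.
by rewrite coefD; apply: IHn.
Qed.

Lemma degleM n a b (f g : itpoly n) :
  degle a f -> degle b g -> degle (a + b) (f * g).
Proof.
elim: n f g => //= n IHn f g [sf cf] [sg cg]; split=> [|i].
  apply: leq_trans (size_polyMleq _ _) _.
  by have := leq_add sf sg; rewrite addSn addnS; case: (_ + _)%N.
rewrite coefM; elim/big_ind: _ => [|x y|j _]; first exact: degle0.
  exact: degleD.
exact: IHn.
Qed.

Lemma degleC n a (c : itpoly n) : degle a c -> degle a (c%:P : itpoly n.+1).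
Proof.
move=> dc; split=> [|i]; first exact: leq_trans (size_polyC_leq1 _) _.
by rewrite coefC; case: eqP => // _; apply: degle0.
Qed.

Lemma degle_int n a (z : int) : degle a (z%:~R : itpoly n).
Proof.
elim: n => // n IHn; have := degleC IHn.
by rewrite -(rmorph_int (@polyC (itpoly n))).
Qed.

Lemma boundedW n a b (f : itpoly n) : (a <= b)%N -> bounded a f -> bounded b f.
Proof.
move=> leab [df nf]; split; first exact: degleW df.
by apply: leq_trans nf _; rewrite leq_exp2l.
Qed.

Lemma bounded0 n a : bounded a (0 : itpoly n).
Proof. by split; [exact: degle0 | rewrite l1norm0]. Qed.

Lemma bounded_int n a (z : int) : (`|z| <= 2 ^ a)%N -> bounded a (z%:~R : itpoly n).
Proof. by split; [exact: degle_int | apply: leq_trans (l1norm_int _ _) _]. Qed.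

Lemma boundedM n a b (f g : itpoly n) :
  bounded a f -> bounded b g -> bounded (a + b) (f * g).
Proof.
move=> [df nf] [dg ng]; split; first exact: degleM.
by rewrite expnD; apply: leq_trans (l1normM _ _) _; apply: leq_mul.
Qed.

Lemma bounded1 n a : bounded a (1 : itpoly n).
Proof. by apply: (@bounded_int n a 1); rewrite expn_gt0. Qed.

Lemma bounded_nat n a k : (k <= 2 ^ a)%N -> bounded a (k%:R : itpoly n).
Proof. exact: (@bounded_int n a k). Qed.

Lemma boundedX n a k (f : itpoly n) : bounded a f -> bounded (k * a) (f ^+ k).
Proof.
move=> bf; elim: k => [|k IHk]; first exact: bounded1.
by rewrite exprS mulSn; apply: boundedM.
Qed.

Lemma bounded_prod n (I : finType) (P : pred I) (a : I -> nat) (F : I -> itpoly n) :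
  (forall i, P i -> bounded (a i) (F i)) -> bounded (\sum_(i | P i) a i) (\prod_(i | P i) F i).
Proof.
move=> bF; elim/big_rec2: _ => [|i x y Pi IH]; first exact: bounded1.
by apply: boundedM => //; apply: bF.
Qed.

Lemma bounded_sum n (I : finType) a l (F : I -> itpoly n) :
  (#|I| <= 2 ^ l)%N -> (forall i, bounded a (F i)) -> bounded (l + a) (\sum_i F i).
Proof.
move=> leI bF; split.
  elim/big_ind: _ => [|x y|i _]; [exact: degle0 | exact: degleD |].
  by apply: degleW (bF i).1; rewrite leq_addl.
apply: leq_trans (l1norm_sum _ _) _.
apply: (@leq_trans (\sum_(i : I) 2 ^ a)%N); first by apply: leq_sum => i _; apply: (bF i).2.
by rewrite sum_nat_const expnD leq_mul2r leI orbT.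
Qed.

Lemma boundedN n a (f : itpoly n) : bounded a f -> bounded a (- f).
Proof.
by move=> bf; rewrite -mulN1r -[a]add0n; apply: boundedM bf; apply: (@bounded_int n 0 (-1)).
Qed.

Lemma boundedD n a (f g : itpoly n) : bounded a f -> bounded a g -> bounded a.+1 (f + g).
Proof.
move=> [df nf] [dg ng]; split.
  by apply: degleW (leqnSn a) _; apply: degleD.
by apply: leq_trans (l1normD _ _) _; rewrite expnS mul2n -addnn leq_add.
Qed.

Lemma boundedC n a (c : itpoly n) : bounded a c -> bounded a (c%:P : itpoly n.+1).
Proof. by move=> [dc nc]; split; [exact: degleC | rewrite l1normC]. Qed.

Lemma bounded_coef n a (f : {poly (itpoly n)}) i :
  bounded a (f : itpoly n.+1) -> bounded a f`_i.
Proof.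
case=> [[sf cf] nf]; split; first exact: cf.
apply: leq_trans nf; have [lt|le] := ltnP i (size f).
  by rewrite /= (bigD1 (Ordinal lt)) //= leq_addr.
by have -> : f`_i = 0; rewrite ?l1norm0 // nth_default.
Qed.

Lemma bounded_polyXn n j : @bounded n.+1 j ('X^j : {poly (itpoly n)}).
Proof.
split.
  split=> [|i]; first by rewrite size_polyXn.
  by rewrite coefXn; exact: (@degle_int n j (i == j)).
have := l1normXM j (1%:P : {poly (itpoly n)}); rewrite mulr1 l1normC => ->.
by apply: leq_trans (@l1norm_nat n 1) _; rewrite expn_gt0.
Qed.

Lemma bounded_var n i : bounded 1 (ivar n i).
Proof.
elim: n => [|n IHn] /=; first exact: bounded0.
by case: ifP => _; [exact: (@bounded_polyXn n 1) | exact: boundedC].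
Qed.

(** Expanding in one variable gives [a + 1 <= 2 ^ a] terms, each with a power costing at most
    [a * t]; so each of the [n] variables adds [a + a * t]. *)
Lemma bounded_eval N (w : nat -> itpoly N) t n a (f : itpoly n) :
    (forall i, (i < n)%N -> bounded t (w i)) -> bounded a f ->
  bounded (a + n * (a + a * t)) (ieval w n f).
Proof.
elim: n f => [|n IHn] f bw bf.
  by rewrite addn0; apply: bounded_int; exact: bf.2.
have bw' i : (i < n)%N -> bounded t (w i) by move=> ?; apply: bw; apply: leqW.
rewrite ievalS (@horner_coef_wide _ a.+1); last first.
  by apply: leq_trans (size_poly _ _) _; exact: bf.1.1.
rewrite mulSn addnCA -addnA; apply: bounded_sum.
  by rewrite card_ord; apply: ltn_expl.
move=> i; rewrite addnC; apply: boundedM.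
  by rewrite coef_map; apply: IHn => //; apply: bounded_coef.
apply: (@boundedW _ (i * t)); first by rewrite leq_mul2r -ltnS ltn_ord orbT.
by apply: boundedX; apply: bw.
Qed.

Lemma fact_le_exp k : (k`! <= 2 ^ (k * k))%N.
Proof.
elim: k => // k IHk; rewrite factS (mulSn k k.+1) expnD leq_mul //.
  exact/ltnW/ltn_expl.
by apply: leq_trans IHk _; rewrite leq_exp2l // leq_mul2l leqnSn orbT.
Qed.

(** The Leibniz expansion has at most [2 ^ (k * k)] signed products of [k] entries. *)
Lemma bounded_det n k a (M : 'M[itpoly n]_k) :
  (forall i j, bounded a (M i j)) -> bounded (k * k + k * a) (\det M).
Proof.
move=> bM; apply: bounded_sum => [|s].
  by rewrite card_Sn; apply: fact_le_exp.
rewrite -[(k * a)%N]add0n; apply: boundedM.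
  by case: (odd_perm s); rewrite ?expr1; [apply: (@bounded_int n 0 (-1)) | apply: bounded1].
by rewrite -{1}(card_ord k) -sum_nat_const; apply: bounded_prod.
Qed.

(** * Elimination of one variable *)

Lemma intr_itpoly_neq0 (n : nat) (z : int) : z != 0 -> z%:~R != 0 :> itpoly n.
Proof.
apply: contraNneq => z0; rewrite -(intr_eq0 algC).
by rewrite -(rmorph_int (ieval (fun _ => 0 : algC) n)) z0 rmorph0.
Qed.

(** Each [w i] is monic of degree [a.+1 ^ i]. With [e = a.+1 ^ n], the coefficients of [f] evaluate
    to polynomials of degree below [e], while [w n] has degree [e]; hence the term of highest power
    of [w n] dominates. Recursively, the leading coefficient is an integer coefficient of [f]. *)
Lemma lead_coef_ieval (T : idomainType) (a : nat) (c : nat -> T) n (f : itpoly n) :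
    (forall z : int, z != 0 -> z%:~R != 0 :> T) ->
    let w i := (c i)%:P + 'X^(a.+1 ^ i) in
    f != 0 -> degle a f ->
  exists2 z : int, z != 0 &
    lead_coef (ieval w n f) = z%:~R /\ (size (ieval w n f) <= a.+1 ^ n)%N.
Proof.
move=> charT w; elim: n f => [|n IHn] f nzf df.
  exists f => //=; rewrite -(rmorph_int (@polyC T)) lead_coefC; split=> //.
  by rewrite (leq_trans (size_polyC_leq1 _)).
have [sf cf] := df; set e := (a.+1 ^ n)%N in IHn *.
have e_gt0 : (0 < e)%N by rewrite expn_gt0.
pose F : {poly (itpoly n)} := f.
have nzF : F != 0 by [].
pose J := (size F).-1; have sF : size F = J.+1 by rewrite prednK // size_poly_gt0.
have nzlF : F`_J != 0 by rewrite -[_`_J]/(lead_coef F) lead_coef_eq0.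
have [z nzz [lz sz]] := IHn _ nzlF (cf J).
have sw : size (w n) = e.+1.
  by rewrite /w addrC size_polyDl size_polyXn // ltnS (leq_trans (size_polyC_leq1 _)).
have mw : w n \is monic.
  rewrite monicE /w addrC lead_coefDl ?lead_coefXn //.
  by rewrite size_polyXn ltnS (leq_trans (size_polyC_leq1 _)).
have swj j : size (w n ^+ j) = (j * e).+1.
  have := size_exp (w n) j; rewrite sw /= mulnC => <-.
  by rewrite prednK // size_poly_gt0 monic_neq0 // monic_exp.
have nzl : ieval w n F`_J != 0 by rewrite -lead_coef_eq0 lz charT.
have E : ieval w n.+1 f = \sum_(j < J) ieval w n F`_j * w n ^+ j + ieval w n F`_J * w n ^+ J.
  rewrite ievalS (@horner_coef_wide _ J.+1) ?big_ord_recr /=; last first.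
    by rewrite -sF; apply: size_poly.
  by rewrite coef_map; congr (_ + _); apply: eq_bigr => j _; rewrite coef_map.
have st : size (ieval w n F`_J * w n ^+ J) = (size (ieval w n F`_J)%R + J * e)%N.
  by rewrite size_Mmonic ?monic_exp // swj addnS.
have ss : (size (\sum_(j < J) ieval w n F`_j * w n ^+ j)%R <= J * e)%N.
  apply: leq_trans (size_sum _ _ _) _; apply/bigmax_leqP => j _.
  have [->|nz] := eqVneq F`_j 0; first by rewrite rmorph0 mul0r size_poly0.
  have [zj nzzj [lj sj]] := IHn _ nz (cf j).
  have nzj : ieval w n F`_j != 0 by rewrite -lead_coef_eq0 lj charT.
  rewrite size_Mmonic ?monic_exp // swj addnS /=.
  apply: (@leq_trans (j.+1 * e)%N); first by rewrite mulSn leq_add2r.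
  by rewrite leq_mul2r ltn_ord orbT.
have lt : (size (\sum_(j < J) ieval w n F`_j * w n ^+ j)%R
           < size (ieval w n F`_J * w n ^+ J)%R)%N.
  by rewrite st (leq_ltn_trans ss) // -[X in (X < _)%N]add0n ltn_add2r size_poly_gt0.
exists z => //; rewrite E addrC lead_coefDl // lead_coef_Mmonic ?monic_exp //; split=> //.
rewrite size_polyDl // st; apply: (@leq_trans (J.+1 * e)%N).
  by rewrite mulSn leq_add2r.
by rewrite expnS leq_mul2r -sF sf orbT.
Qed.

Section Sylvester.

(* Sylvester matrix for the formal degrees a and b, so that it commutes with
   specialization even when leading coefficients vanish. *)
Definition sylvester (T : nzRingType) (a b : nat) (p q : {poly T}) : 'M[T]_(b + a) :=
  col_mx (\matrix_(i < b, j < b + a) (p * 'X^i)`_j)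
         (\matrix_(i < a, j < b + a) (q * 'X^i)`_j).

Lemma map_sylvester (A B : nzRingType) (g : {rmorphism A -> B}) a b p q :
  map_mx g (sylvester a b p q) = sylvester a b (map_poly g p) (map_poly g q).
Proof.
rewrite /sylvester map_col_mx; congr col_mx; apply/matrixP => i j; rewrite !mxE;
by rewrite !coefMXn; case: ifP => _; rewrite ?rmorph0 ?coef_map.
Qed.

(** The column of powers of [x] lies in the kernel, so [\det M] kills it, and its entry of index 0
    is 1. No division occurs, hence the validity over any commutative ring. *)
Lemma det_sylvester_root (T : comNzRingType) a b (p q : {poly T}) x :
    (0 < b + a)%N -> (size p <= a.+1)%N -> (size q <= b.+1)%N ->
  p.[x] = 0 -> q.[x] = 0 -> \det (sylvester a b p q) = 0.
Proof.
move=> gt0 sp sq px qx; set M := sylvester _ _ _ _.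
pose v : 'cV[T]_(b + a) := \col_j x ^+ j.
have ev k (F : {poly T}) (i : 'I_k) : (size F + i <= b + a)%N ->
    F.[x] = 0 -> \sum_(j < b + a) (F * 'X^i)`_j * x ^+ j = 0.
  move=> sF Fx; rewrite -horner_coef_wide ?hornerM ?Fx ?mul0r //.
  apply: leq_trans (size_polyMleq _ _) _; rewrite size_polyXn addnS; exact: sF.
have Mv : M *m v = 0.
  rewrite /M /sylvester mul_col_mx -[RHS]col_mx0; congr col_mx; apply/colP => k.
    rewrite mxE [RHS]mxE; under eq_bigr do rewrite !mxE.
    apply: ev => //; apply: leq_trans (leq_add sp (leqnn k)) _.
    by rewrite addSnnS addnC leq_add2r.
  rewrite mxE [RHS]mxE; under eq_bigr do rewrite !mxE.
  apply: ev => //; apply: leq_trans (leq_add sq (leqnn k)) _.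
  by rewrite addSnnS leq_add2l.
have /matrixP/(_ (Ordinal gt0) 0) : \det M *: v = 0.
  by rewrite -mul_scalar_mx -mul_adj_mx -mulmxA Mv mulmx0.
by rewrite !mxE expr0 mulr1.
Qed.

(** A left kernel vector yields [U * p + V * q = 0] with [V] nonzero of degree below that of [p].
    Were [p] and [q] coprime, [p] would divide [V]. Here [p] has its full formal degree, while [q]
    may drop below its own. *)
Lemma det_sylvester_eq0 (K : closedFieldType) a b (p q : {poly K}) :
    size p = a.+1 -> (size q <= b.+1)%N -> \det (sylvester a b p q) = 0 ->
  exists x, root p x /\ root q x.
Proof.
move=> sp sq /eqP/det0P[v nzv].
rewrite -[v]hsubmxK in nzv *; set U := lsubmx v in nzv *; set V := rsubmx v in nzv *.
rewrite mul_row_col => UV0.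
have nzp : p != 0 by rewrite -size_poly_gt0 sp.
have band k (W : 'rV[K]_k) (F : {poly K}) j :
    (W *m (\matrix_(i < k, j < b + a) (F * 'X^i)`_j)) 0 j = (rVpoly W * F)`_j.
  rewrite mxE /rVpoly poly_def mulr_suml coef_sum.
  by apply: eq_bigr => i _; rewrite mxE -scalerAl coefZ (valK i) ['X^_ * F]mulrC.
have E : rVpoly U * p + rVpoly V * q = 0.
  apply/polyP => j; rewrite coef0.
  have [lt|ge] := ltnP j (b + a).
    by move/matrixP/(_ 0 (Ordinal lt)): UV0; rewrite mxE !band mxE coefD.
  apply: nth_default; apply: leq_trans ge; apply: leq_trans (size_polyD _ _) _.
  rewrite geq_max; apply/andP; split; apply: leq_trans (size_polyMleq _ _) _.
    by rewrite sp addnS /= leq_add2r; apply: size_poly.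
  have := leq_add (size_poly _ _ : (size (rVpoly V) <= a)%N) sq.
  by rewrite addnS (addnC a b); case: (size _ + _)%N.
have nzV : rVpoly V != 0.
  apply: contraNneq nzv => V0; move: E; rewrite V0 mul0r addr0 => /eqP.
  rewrite mulf_eq0 (negPf nzp) orbF => /eqP U0.
  by rewrite -[U]rVpolyK -[V]rVpolyK U0 V0 !linear0 row_mx0.
have [cop|ncop] := boolP (coprimep p q).
  have : p %| rVpoly V.
    rewrite -(Gauss_dvdpl _ cop).
    by move/eqP: E; rewrite addrC addr_eq0 => /eqP->; rewrite dvdpNr dvdp_mull.
  move/(dvdp_leq nzV); rewrite sp => /leq_trans/(_ (size_poly _ _)).
  by rewrite ltnn.
have /closed_rootP[x] : size (gcdp p q) != 1%N by [].
by rewrite root_gcd => /andP[px qx]; exists x.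
Qed.

End Sylvester.

(* The product over the roots z of p of the polynomials sum_i g_i(z) U^i vanishes
   at more points than its degree, so one of its factors is zero. *)
Lemma common_root_pencil (K : closedFieldType) (p : {poly K}) r (g : nat -> {poly K}) N :
    (forall z : int, z%:~R = 0 :> K -> z = 0) ->
    p != 0 -> ((size p).-1 * r <= N)%N ->
    (forall u : nat, (u <= N)%N ->
       exists x, root p x /\ root (\sum_(i < r) u%:R ^+ i *: g i) x) ->
  exists x, root p x /\ forall i, (i < r)%N -> root (g i) x.
Proof.
move=> charK nzp leN hN; have [rs prs] := closed_field_poly_normal p.
have sp : size p = (size rs).+1.
  by rewrite prs size_scale ?lead_coef_eq0 // size_prod_XsubC.
have rp x : root p x = (x \in rs).
  by rewrite prs rootZ ?lead_coef_eq0 // root_prod_XsubC.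
pose G z : {poly K} := \poly_(i < r) (g i).[z].
have [/hasP[z zrs /eqP Gz0]|/hasPn nzG] := boolP (has (fun z => G z == 0) rs).
  exists z; rewrite rp; split=> // i lti; apply/rootP.
  by move/polyP/(_ i): Gz0; rewrite coef_poly lti coef0.
pose GG := \prod_(z <- rs) G z.
have nzGG : GG != 0 by rewrite prodf_seq_neq0; apply/allP => z /nzG.
have sGG : (size GG <= N.+1)%N.
  apply: (@leq_trans (size rs * r).+1); last by rewrite ltnS; move: leN; rewrite sp.
  rewrite /GG; elim: rs {prs sp rp nzG GG nzGG} => [|z rs IH].
    by rewrite big_nil size_poly1.
  rewrite big_cons; apply: leq_trans (size_polyMleq _ _) _ => /=.
  have := leq_add (size_poly r (fun i => (g i).[z])) IH; rewrite addnS -/(G z).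
  by rewrite mulSn; case: (_ + size _)%N => // k; apply: leq_trans.
pose us : seq K := [seq (u : nat)%:R | u <- iota 0 N.+1].
have uus : uniq us.
  rewrite map_inj_uniq ?iota_uniq // => u v /eqP; rewrite -subr_eq0 => /eqP uv.
  have /charK/eqP : (u%:Z - v%:Z)%:~R = 0 :> K by rewrite rmorphB.
  by rewrite subr_eq0 => /eqP[].
have rus : all (root GG) us.
  apply/allP => v /mapP[u + ->]; rewrite mem_iota add0n ltnS => /andP[_ /hN].
  move=> [x []]; rewrite rp => xrs /rootP hx; apply/rootP.
  rewrite /GG horner_prod; apply/eqP; rewrite prodf_seq_eq0; apply/hasP; exists x => //=.
  rewrite (horner_coef_wide _ (size_poly _ _)); apply/eqP; rewrite -[RHS]hx horner_sum.
  by apply: eq_bigr => i _; rewrite coef_poly ltn_ord hornerZ mulrC.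
have := max_poly_roots nzGG rus uus; rewrite size_map size_iota => /leq_trans/(_ sGG).
by rewrite ltnn.
Qed.

Definition common_zero (T : comNzRingType) n r (f : nat -> itpoly n) :=
  exists w : nat -> T, forall i, (i < r)%N -> ieval w n (f i) = 0.

Lemma intr_Fpbar_eq0 p (z : int) :
  prime p -> (z%:~R == 0 :> Fpbar p) = (p %| `|z|)%N.
Proof.
move=> pp; have [FtoK _] := projT2 (countable_algebraic_closure 'F_p).
rewrite (dvdn_pcharf (rmorph_pchar FtoK (pchar_Fp pp))).
by case: z => n //; rewrite NegzE abszN rmorphN oppr_eq0.
Qed.

Section Elimination.

Variables (n a : nat).

(* Under the weights (a + 1)^i all monomials of degree at most a in each
   variable get distinct powers of the eliminated variable. *)
Definition shift_coord i : {poly (itpoly n)} :=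
  (if i is j.+1 then ivar n j else 0)%:P + 'X^(a.+1 ^ i).

Lemma ieval_shift (T : comNzRingType) (x : nat -> T) y (f : itpoly n.+1) :
  (map_poly (ieval x n) (ieval shift_coord n.+1 f)).[y] =
  ieval (fun i => (if i is j.+1 then x j else 0) + y ^+ (a.+1 ^ i)) n.+1 f.
Proof.
pose g : {rmorphism {poly (itpoly n)} -> T} := horner_eval y \o map_poly (ieval x n).
rewrite -[LHS]/(g _) rmorph_ieval; apply: eq_ieval => i lti /=.
rewrite rmorphD /= map_polyC map_polyXn /= /horner_eval hornerD hornerC hornerXn.
congr (_ + _); case: i lti => [|i] lti; first by rewrite rmorph0.
exact: ieval_var.
Qed.

Lemma bounded_shift_coord i :
  (i < n.+1)%N -> @bounded n.+1 ((a.+1 ^ n).+1) (shift_coord i).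
Proof.
move=> lti; apply: boundedD.
  apply: boundedC; case: i lti => [|i] lti; first exact: bounded0.
  by apply: (@boundedW _ 1); rewrite ?expn_gt0 //; apply: bounded_var.
by apply: boundedW (bounded_polyXn n _); rewrite leq_pexp2l.
Qed.

Variables (r : nat) (f : nat -> itpoly n.+1).
Hypotheses (a_ge2 : (2 <= a)%N) (r_le : (r <= a)%N).
Hypothesis bf : forall i, (i < r)%N -> bounded a (f i).

Let shifted i : {poly (itpoly n)} := ieval shift_coord n.+1 (f i).

Definition pencil (u : nat) : {poly (itpoly n)} :=
  \sum_(i < r) u%:R ^+ i * shifted i.

(** [beta] bounds the shifted polynomials and [gamma] their pencils. Both are powers of [a] with
    exponents depending on [n] alone, which keeps every bound polynomial in [a]. *)
Let beta := (a ^ (3 * n + 3))%N.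
Let gamma := (a ^ (3 * n + 6))%N.

Let a_gt0 : (0 < a)%N. Proof. exact: ltnW. Qed.
Let beta_gt0 : (0 < beta)%N. Proof. by rewrite expn_gt0 a_gt0. Qed.
Let gammaE : gamma = (a * (a * (a * beta)))%N.
Proof. by rewrite /gamma /beta -!expnS; congr expn; lia. Qed.

Lemma bounded_shifted i : (i < r)%N -> @bounded n.+1 beta (shifted i).
Proof.
move=> lti; apply: boundedW (bounded_eval bounded_shift_coord (bf lti)).
rewrite /beta; have ley : (a.+1 ^ n <= a ^ (2 * n))%N.
  by rewrite expnM; case: n => // k; rewrite leq_exp2r //; nia.
have lex : (n.+1 <= a ^ n)%N.
  by apply: leq_trans (ltn_expl n (leqnn 2)) _; case: n => // k; rewrite leq_exp2r.
have -> : (3 * n + 3 = 3 + (n + 2 * n))%N by lia.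
rewrite (expnD a 3) (expnD a n); have y_gt0 : (0 < a ^ (2 * n))%N by rewrite expn_gt0 a_gt0.
have x_gt0 : (0 < a ^ n)%N by rewrite expn_gt0 a_gt0.
move: (a ^ n)%N (a ^ (2 * n))%N (a.+1 ^ n)%N n.+1 ley lex x_gt0 y_gt0 => x y v m ley lex x_gt0 y_gt0.
have le1 : (a + m * (a + a * v.+1) <= a + x * (a + a * y.+1))%N.
  by rewrite leq_add2l leq_mul // leq_add2l leq_mul2l ltnS ley orbT.
have z1 : (x <= x * y)%N by nia.
have z0 : (1 <= x * y)%N by nia.
have le2 : (a + x * (a + a * y.+1) <= 4 * (a * (x * y)))%N by nia.
apply: leq_trans le1 (leq_trans le2 _).
have -> : (a ^ 3 * (x * y) = (a * a) * (a * (x * y)))%N by rewrite !expnS expn0; lia.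
by rewrite leq_mul2r; apply/orP; right; nia.
Qed.

Lemma bounded_pencil u : (u <= beta * a)%N -> @bounded n.+1 gamma (pencil u).
Proof.
move=> leu; apply: (@boundedW _ (a + (a * (beta * a) + beta))).
  rewrite gammaE; have : (a * (2 * beta) <= a * (a * beta))%N by rewrite leq_mul2l leq_mul2r a_ge2 !orbT.
  have : (a * (a * (2 * beta)) <= a * (a * (a * beta)))%N by rewrite !leq_mul2l leq_mul2r a_ge2 !orbT.
  have : (2 * beta <= a * beta)%N by rewrite leq_mul2r a_ge2 orbT.
  nia.
apply: (@bounded_sum n.+1 _ (a * (beta * a) + beta) a) => [|i].
  by rewrite card_ord; apply: leq_trans r_le (ltnW (ltn_expl _ _)).
apply: boundedM; last exact: bounded_shifted.
apply: (@boundedW _ (i * (beta * a))).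
  by rewrite leq_mul2r (leq_trans (ltnW (ltn_ord i)) r_le) orbT.
apply: boundedX; apply: (@bounded_nat n.+1).
by apply: leq_trans leu (ltnW (ltn_expl _ _)).
Qed.

Variable i0 : nat.
Hypothesis i0_lt : (i0 < r)%N.

(** The first formal degree is the exact degree of [shifted i0], whose leading coefficient will be a
    nonzero integer; [gamma] is an upper bound for the degree of the pencil. *)
Definition eliminant (u : nat) : itpoly n :=
  \det (sylvester (size (shifted i0)).-1 gamma (shifted i0) (pencil u)).

Let size_i0 : ((size (shifted i0)).-1 <= beta)%N.
Proof.
have [[]] := bounded_shifted i0_lt.
by case: (size _).
Qed.

Let gamma_ge : (beta * 2 <= gamma)%N.
Proof.
rewrite gammaE (_ : a * (a * (a * beta)) = beta * (a * (a * a)))%N; last by lia.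
by rewrite leq_mul2l; apply/orP; right; nia.
Qed.

(** The determinant has order at most [a * gamma] and entries bounded by [gamma], which costs at
    most [2 * a ^ 2 * gamma ^ 2 <= a ^ 3 * gamma ^ 2]. *)
Lemma bounded_eliminant u :
  (u <= beta * a)%N -> bounded (a ^ (6 * n + 15)) (eliminant u).
Proof.
move=> leu.
set k := (gamma + (size (shifted i0)).-1)%N.
have lek : (k <= a * gamma)%N.
  have : (2 * gamma <= a * gamma)%N by rewrite leq_mul2r a_ge2 orbT.
  by apply: leq_trans; rewrite mul2n -addnn leq_add2l; nia.
apply: (@boundedW _ (k * k + k * gamma)).
  have -> : (a ^ (6 * n + 15) = a * (a * (a * (gamma * gamma))))%N.
    by rewrite /gamma -expnD -!expnS; congr expn; lia.
  apply: (@leq_trans ((a * gamma) * (a * gamma) + (a * gamma) * gamma)%N).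
    by rewrite leq_add // leq_mul.
  set G := (gamma * gamma)%N; have -> : (a * gamma * (a * gamma) = a * (a * G))%N by rewrite /G; lia.
  have -> : (a * gamma * gamma = a * G)%N by rewrite /G; lia.
  apply: (@leq_trans (2 * (a * (a * G)))%N).
    by rewrite [X in (_ <= X)%N]mul2n -addnn leq_add2l leq_mul2l leq_pmull ?orbT.
  have -> : (2 * (a * (a * G)) = a * (a * (2 * G)))%N by lia.
  by rewrite !leq_mul2l leq_mul2r a_ge2 !orbT.
apply: bounded_det => i j; have bc k' (F : {poly (itpoly n)}) l m :
    @bounded n.+1 k' F -> (k' <= gamma)%N -> bounded gamma (F * 'X^l)`_m.
  move=> bF lek'; rewrite coefMXn; case: ifP => _; first exact: bounded0.
  exact: boundedW lek' (bounded_coef _ bF).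
rewrite /sylvester; case: (split_ordP i) => l ->; rewrite ?col_mxEu ?col_mxEd mxE.
  by apply: bc (bounded_shifted i0_lt) _; apply: leq_trans gamma_ge; rewrite leq_pmulr.
exact: bc (bounded_pencil leu) _.
Qed.

Lemma map_pencil (T : comNzRingType) (x : nat -> T) u :
  map_poly (ieval x n) (pencil u) =
  \sum_(i < r) u%:R ^+ i *: map_poly (ieval x n) (shifted i).
Proof.
rewrite rmorph_sum; apply: eq_bigr => i _.
by rewrite rmorphM rmorphXn rmorph_nat /= -mul_polyC rmorphXn rmorph_nat.
Qed.

Let size_pencil u : (u <= beta * a)%N -> (size (pencil u) <= gamma.+1)%N.
Proof. by move=> leu; have [[]] := bounded_pencil leu. Qed.

(** The change of coordinates is triangular, hence invertible over any field: it turns [z] into a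
    point [(x, y)] where all shifted polynomials vanish, and [y] is a common root of the two
    polynomials in each resultant. *)
Lemma common_zero_eliminant (K : fieldType) :
  common_zero K r f -> common_zero K (beta * a).+1 eliminant.
Proof.
case=> z fz; pose y := z 0%N; pose x j := z j.+1 - y ^+ (a.+1 ^ j.+1).
have hz i : (i < r)%N -> (map_poly (ieval x n) (shifted i)).[y] = 0.
  move=> lti; rewrite ieval_shift -[RHS](fz i lti); apply: eq_ieval => -[|j] _.
    by rewrite expn0 expr1 add0r.
  by rewrite subrK.
exists x => u; rewrite ltnS => leu; rewrite /eliminant -det_map_mx map_sylvester.
apply: (@det_sylvester_root _ _ _ _ _ y).
- by rewrite addn_gt0 (leq_trans _ gamma_ge) // muln_gt0 beta_gt0.
- by apply: leq_trans (size_poly _ _) _; case: (size _).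
- by apply: leq_trans (size_poly _ _) _; apply: size_pencil.
- exact: hz.
rewrite map_pencil horner_sum big1 // => i _.
by rewrite hornerZ hz ?mulr0.
Qed.

(** Characteristic 0 enters twice. The integer leading coefficient of [shifted i0] survives
    specialization at [x], so a zero determinant gives a common root; and the [beta * a + 1] values
    of [u] are distinct, enough for a polynomial of degree at most [beta] and [r <= a] members of
    the pencil. *)
Lemma eliminant_common_zero :
  f i0 != 0 -> common_zero algC (beta * a).+1 eliminant -> common_zero algC r f.
Proof.
move=> nzf [x hx]; set psi := map_poly (ieval x n).
have [z nzz [lz _]] := lead_coef_ieval (fun i => if i is j.+1 then ivar n j else 0)
  (@intr_itpoly_neq0 n) nzf (bf i0_lt).1.
have nzl : ieval x n (lead_coef (shifted i0)) != 0.
  by rewrite /shifted lz rmorph_int intr_eq0.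
have sz := size_map_poly_id0 nzl.
have nzs : shifted i0 != 0.
  by apply: contraNneq nzl => ->; rewrite lead_coef0 rmorph0.
have s_gt0 : (0 < size (shifted i0))%N by rewrite size_poly_gt0.
have [y [_ hy]] : exists y, root (psi (shifted i0)) y /\
    forall i, (i < r)%N -> root (psi (shifted i)) y.
  apply: (@common_root_pencil _ _ _ _ (beta * a)) => [k /eqP||| u leu].
  - by rewrite intr_eq0 => /eqP.
  - by rewrite -size_poly_gt0 sz.
  - by rewrite sz leq_mul.
  rewrite -map_pencil; apply: (@det_sylvester_eq0 _ (size (shifted i0)).-1 gamma).
  - by rewrite sz prednK.
  - by apply: leq_trans (size_poly _ _) _; apply: size_pencil.
  by rewrite -map_sylvester det_map_mx; apply: hx.
exists (fun i => (if i is j.+1 then x j else 0) + y ^+ (a.+1 ^ i)) => i lti.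
by rewrite -ieval_shift; apply/rootP/hy.
Qed.

End Elimination.

(** * The arithmetic Nullstellensatz, by induction on the number of variables *)

Theorem arithmetic_nullstellensatz n : exists k, forall a r (f : nat -> itpoly n),
    (2 <= a)%N -> (r <= a)%N -> (forall i, (i < r)%N -> bounded a (f i)) ->
    ~ common_zero algC r f ->
  exists B : nat, [/\ (0 < B)%N, (B <= 2 ^ (a ^ k))%N &
    forall p, prime p -> ~~ (p %| B)%N -> ~ common_zero (Fpbar p) r f].
Proof.
elim: n => [|n [k IHn]].
  exists 1%N => a r f a_ge2 _ bf ncz.
  have [i0 [lt0 nz0]] : exists i, (i < r)%N /\ f i != 0.
    apply: contrapT => nex; apply: ncz; exists (fun _ => 0) => i lti.
    apply/eqP; rewrite intr_eq0; apply: contrapT => /negP nz.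
    by apply: nex; exists i.
  (* Without variables the equations are integers, and any nonzero one serves as [B]. *)
  exists `|f i0 : int|%N; split; first by rewrite absz_gt0.
    by rewrite expn1; have [] := bf _ lt0.
  move=> p pp ndvd [w /(_ _ lt0)/eqP]; rewrite /= intr_Fpbar_eq0 //.
  exact/negP.
(* Each elimination replaces [a] by [a ^ (6 * n + 15)], so the exponents multiply. *)
exists ((6 * n + 15) * k)%N => a r f a_ge2 r_le bf ncz.
have [i0 [lt0 nz0]] : exists i, (i < r)%N /\ f i != 0.
  apply: contrapT => nex; apply: ncz; exists (fun _ => 0) => i lti.
  have -> : f i = 0 by apply/eqP; apply: contrapT => /negP nz; apply: nex; exists i.
  by rewrite rmorph0.
set N := (a ^ (3 * n + 3) * a).+1.
have [|||//|B [B_gt0 B_le hB]] := IHn (a ^ (6 * n + 15))%N N (eliminant a r f i0).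
- by apply: (leq_trans a_ge2); rewrite -{1}[a]expn1 leq_exp2l //; lia.
- by rewrite /N -expnSr ltn_exp2l //; lia.
- by move=> u; rewrite ltnS => leu; apply: bounded_eliminant.
- by move=> /(eliminant_common_zero a_ge2 r_le bf lt0 nz0).
exists B; split=> //; first by rewrite expnM.
move=> p pp ndvd cz; apply: hB pp ndvd _.
exact: common_zero_eliminant cz.
Qed.

(** * Orbits over a common denominator *)

(** This is $Q^e F(A/Q)$ with denominators cleared, for [F] of degree at most [e]; being
    division-free, it commutes with ring morphisms. *)
Definition homog_eval (T : comNzRingType) m e (F : {mpoly int[m]}) (A : 'I_m -> T) (Q : T) : T :=
  \sum_(k : 'X_{1..m < e.+1})
     (F@_k)%:~R * (\prod_i A i ^+ k i) * Q ^+ (e - mdeg k).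

Section HomogEval.
Variables (m e : nat) (F : {mpoly int[m]}).

Lemma rmorph_homog_eval (T U : comNzRingType) (g : {rmorphism T -> U}) A Q :
  g (homog_eval e F A Q) = homog_eval e F (g \o A) (g Q).
Proof.
rewrite rmorph_sum; apply: eq_bigr => k _.
rewrite !rmorphM rmorph_int rmorphXn rmorph_prod; congr (_ * _ * _).
by apply: eq_bigr => i _; rewrite rmorphXn.
Qed.

Lemma zevalE (K : fieldType) (w : 'I_m -> K) : (msize F <= e.+1)%N ->
  zeval F w = \sum_(k : 'X_{1..m < e.+1}) (F@_k)%:~R * \prod_i w i ^+ k i.
Proof.
move=> sF; rewrite /zeval (map_mpolyE _ sF) raddf_sum /=; apply: eq_bigr => k _.
by rewrite mevalZ mevalX.
Qed.

Lemma homog_evalE (K : fieldType) (A : 'I_m -> K) Q :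
    (msize F <= e.+1)%N -> Q != 0 ->
  homog_eval e F A Q = Q ^+ e * zeval F (fun i => A i / Q).
Proof.
move=> sF nzQ; rewrite zevalE // mulr_sumr; apply: eq_bigr => k _.
rewrite mulrCA -mulrA; congr (_ * _); under [in RHS]eq_bigr do rewrite expr_div_n.
rewrite prodf_div mulrC; rewrite prodrXr -mdegE.
have le : (mdeg k <= e)%N by rewrite -ltnS bmdeg.
have -> : Q ^+ e = Q ^+ (e - mdeg k) * Q ^+ mdeg k by rewrite -exprD subnK.
by rewrite -mulrA; congr (_ * _); rewrite mulrC divfK ?expf_neq0.
Qed.

(** The number of monomials is at most 2 to that number, a constant once [m] and [e] are fixed. *)
Lemma bounded_homog_eval n h t (A : 'I_m -> itpoly n) Q :
    (forall k, (`|F@_k| <= 2 ^ h)%N) ->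
    (forall i, bounded t (A i)) -> bounded t Q ->
  bounded (#|{: 'X_{1..m < e.+1}}| + (h + e * t)) (homog_eval e F A Q).
Proof.
move=> hF bA bQ; apply: bounded_sum => [|k]; first exact/ltnW/ltn_expl.
have le : (mdeg k <= e)%N by rewrite -ltnS bmdeg.
have -> : (h + e * t = h + mdeg k * t + (e - mdeg k) * t)%N by rewrite -addnA -mulnDl subnKC.
apply: boundedM; last exact: boundedX.
apply: boundedM; first exact: bounded_int.
rewrite mdegE big_distrl /=; apply: bounded_prod => i _; exact: boundedX.
Qed.

End HomogEval.

Lemma cross_mul (K : fieldType) (a b c e : K) :
  b != 0 -> e != 0 -> a / b = c / e -> c * b = a * e.
Proof. by move=> nzb nze /eqP; rewrite eqr_div // => /eqP ->. Qed.

Lemma ZtoQX_inj m : injective (@ZtoQX m).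
Proof.
move=> F G /eqP; rewrite /ZtoQX tofrac_eq => /eqP /mpolyP eFG; apply/mpolyP => k.
by have /eqP := eFG k; rewrite !mcoeff_map_mpoly eqr_int => /eqP.
Qed.

(* The n-th point of the orbit of x as numerators over a common denominator. The
   factor AQ.2 makes the n-th denominator vanish as soon as an earlier one does. *)
Fixpoint orbit_frac (T : comNzRingType) m d (S : ratsystem m) (x : 'I_m -> T) n :
    ('I_m -> T) * T :=
  if n is k.+1 then
    let AQ := orbit_frac d S x k in
    let D j := homog_eval d (denom (S j)) AQ.1 AQ.2 in
    (fun i => AQ.2 * (homog_eval d (numer (S i)) AQ.1 AQ.2 * \prod_(j | j != i) D j),
     AQ.2 * \prod_j D j)
  else (x, 1).

Section OrbitFrac.
Variables (m d : nat) (S : ratsystem m).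
Hypothesis degS : forall i, (ratdegree (S i) <= d)%N.

(** Only ring operations occur in [orbit_frac], so a fraction computed once with integer polynomials
    specializes to every field. *)
Lemma rmorph_orbit_frac (T U : comNzRingType) (g : {rmorphism T -> U}) x n :
  (forall i, g ((orbit_frac d S x n).1 i) = (orbit_frac d S (g \o x) n).1 i) /\
  g (orbit_frac d S x n).2 = (orbit_frac d S (g \o x) n).2.
Proof.
elim: n => [|n [IHA IHQ]] /=; first by rewrite rmorph1.
have E e F : g (homog_eval e F (orbit_frac d S x n).1 (orbit_frac d S x n).2) =
    homog_eval e F (orbit_frac d S (g \o x) n).1 (orbit_frac d S (g \o x) n).2.
  by rewrite rmorph_homog_eval IHQ; congr homog_eval; apply: funext => i; apply: IHA.
split=> [i|]; rewrite !rmorphM rmorph_prod IHQ ?E; do ?congr (_ * _);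
by apply: eq_bigr => j _; rewrite E.
Qed.

Let msize_numer i : (msize (numer (S i)) <= d.+1)%N.
Proof. by have := degS i; rewrite geq_max => /andP[+ _]; rewrite /mdegree; case: (mmeasure _ _). Qed.

Let msize_denom i : (msize (denom (S i)) <= d.+1)%N.
Proof. by have := degS i; rewrite geq_max => /andP[_]; rewrite /mdegree; case: (mmeasure _ _). Qed.

Section Field.
Variables (K : fieldType) (x : 'I_m -> K).
Implicit Type n : nat.
Let num n := (orbit_frac d S x n).1.
Let den n := (orbit_frac d S x n).2.
Let point n i := num n i / den n.

Lemma orbit_frac_pole n : den n != 0 -> (den n.+1 == 0) = is_pole S (point n).
Proof.
move=> nz; rewrite /den /= mulf_eq0 (negPf nz) /=.
apply/idP/existsP => [|[j dj]]; first move/prodf_eq0 => [j _ dj]; first exists j.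
  by move: dj; rewrite homog_evalE // mulf_eq0 expf_eq0 (negPf nz) andbF.
by apply/prodf_eq0; exists j => //; rewrite homog_evalE // mulf_eq0 [X in _ || X]dj orbT.
Qed.

Lemma orbit_frac_step n : den n.+1 != 0 ->
  forall i, point n.+1 i = sysval S (point n) i.
Proof.
move=> nz i; have nzn : den n != 0 by apply: contraNneq nz => Q0; rewrite /den /= -/(den n) Q0 mul0r.
rewrite ffunE /point /num /den /=; move: nz; rewrite /den /= (bigD1 i) //=.
rewrite -/(den n) -/(num n) !homog_evalE //.
set P := \prod_(j | j != i) _; set p := zeval _ _; set q := zeval _ _.
rewrite !mulf_eq0 !negb_or => /and3P[_ /andP[nzd nzq] nzP].
by field; rewrite nzn nzP nzq nzd.
Qed.

(** A vanishing denominator propagates to all later ones, so one inequation encodes that no pole is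
    met before time [n]. *)
Lemma orbit_at_frac (w : {ffun 'I_m -> K}) n : w =1 x ->
  orbit_at S w n = if den n != 0 then Some [ffun i => point n i] else None.
Proof.
move=> wx; elim: n => [|n IHn] /=.
  rewrite /den /= oner_eq0 /=; congr Some; apply/ffunP => i.
  by rewrite ffunE /point /num /den /= divr1.
rewrite IHn; have [Q0|nz] /= := eqVneq (den n) 0.
  by rewrite /den /= -/(den n) Q0 mul0r eqxx.
have -> : is_pole S [ffun i => point n i] = (den n.+1 == 0).
  rewrite orbit_frac_pole //; congr is_pole; apply: funext => i; exact: ffunE.
have [Q0|nz1] /= := eqVneq (den n.+1) 0 => //.
congr Some; apply/ffunP => i; rewrite [RHS]ffunE orbit_frac_step //.
by congr (sysval S _ i); apply: funext => j; rewrite ffunE.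
Qed.

Lemma on_variety_frac s (P : 'I_s -> {mpoly int[m]}) D n :
    (forall j, (mdegree (P j) <= D)%N) -> den n != 0 ->
  on_variety P (point n) = [forall j, homog_eval D (P j) (num n) (den n) == 0].
Proof.
move=> degP nz; apply: eq_forallb => j; rewrite homog_evalE //.
  by rewrite mulf_eq0 expf_eq0 (negPf nz) andbF.
by have := degP j; rewrite /mdegree; case: (mmeasure _ _).
Qed.

Lemma den_le n k : (k <= n)%N -> den n != 0 -> den k != 0.
Proof.
elim: n => [|n IHn]; first by rewrite leqn0 => /eqP->.
rewrite leq_eqVlt => /predU1P[->//|]; rewrite ltnS => le nz; apply: IHn => //.
by apply: contraNneq nz => Q0; rewrite /den /= -/(den n) Q0 mul0r.
Qed.

End Field.

Lemma iterate_frac n (x := fun i => ZtoQX 'X_i : ratfun m) :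
  (orbit_frac d S x n).2 != 0 ->
  forall i, iterate S n i = (orbit_frac d S x n).1 i / (orbit_frac d S x n).2.
Proof.
elim: n => [|n IHn] nz i; first by rewrite /= divr1.
rewrite orbit_frac_step //=; congr (sysval S _ i); apply: funext => j.
by apply: IHn; apply: (den_le (leqnSn n)).
Qed.

(* The reduced iterate and the fraction below are equal in Q(X), hence have equal
   values at w after cross multiplication over Z; no cancellation is compared. *)
Lemma iterate_orbit (K : fieldType) (w : {ffun 'I_m -> K}) n v :
    orbit_at S w n = Some v -> ~~ is_pole (iterate S n) w ->
  sysval (iterate S n) w = v.
Proof.
rewrite (orbit_at_frac _ (fun i => erefl)); case: ifP => // nz [<-] npole.
(* [g] evaluates at [w], [z] embeds into the rational functions; both specialize the same fraction
   over the generic point [X]. *)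
pose g : {rmorphism {mpoly int[m]} -> K} := meval w \o map_mpoly intr.
pose z : {rmorphism {mpoly int[m]} -> ratfun m} := @FracField.tofrac _ \o map_mpoly intr.
pose X i : {mpoly int[m]} := 'X_i.
have gX : g \o X = w by apply: funext => i; rewrite /g /= map_mpolyX mevalXU.
have [gA gQ] := rmorph_orbit_frac g X n; rewrite gX in gA gQ.
have [zA zQ] := rmorph_orbit_frac z X n.
have nzQ : (orbit_frac d S X n).2 != 0.
  by apply: contraNneq nz => Q0; rewrite -gQ Q0 rmorph0.
have nzz F : F != 0 -> z F != 0.
  by apply: contra_neq => z0; apply: (@ZtoQX_inj m); rewrite -[LHS]/(z F) z0 -[RHS]/(z 0) rmorph0.
have nzzQ := nzz _ nzQ; rewrite zQ in nzzQ.
apply/ffunP => i; rewrite !ffunE -gA -gQ.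
have /negP ndi : ~~ (zeval (denom (iterate S n i)) w == 0).
  by apply: contra npole => di; apply/existsP; exists i.
have [nzG _ eI] : is_reduced_form (iterate S n i) (reduced_form (iterate S n i)).
  by rewrite /reduced_form; case: cid.
have eI' : iterate S n i = z ((orbit_frac d S X n).1 i) / z (orbit_frac d S X n).2.
  by rewrite zA zQ; apply: iterate_frac nzzQ i.
have E : numer (iterate S n i) * (orbit_frac d S X n).2 =
         (orbit_frac d S X n).1 i * denom (iterate S n i).
  apply: (@ZtoQX_inj m); rewrite -[LHS]/(z _) -[RHS]/(z _) (rmorphM z) (rmorphM z).
  have eI2 : z ((orbit_frac d S X n).1 i) / z (orbit_frac d S X n).2 =
      z (numer (iterate S n i)) / z (denom (iterate S n i)) := etrans (esym eI') eI.
  exact: (cross_mul (nzz _ nzQ) (nzz _ nzG) eI2).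
have := congr1 g E; rewrite (rmorphM g) (rmorphM g) => Eg.
have nzgQ : g (orbit_frac d S X n).2 != 0 by rewrite gQ.
have nzgG : g (denom (iterate S n i)) != 0 by apply/negP.
rewrite -[zeval (numer _) w]/(g _) -[zeval (denom _) w]/(g _).
by apply/eqP; rewrite eqr_div //; apply/eqP.
Qed.

(** A step sends the bound [t] to [t + m * u] with [u] at most a constant times [t], whence growth
    exponential in [k]. *)
Lemma bounded_orbit_frac h n k (x : 'I_m -> itpoly n) :
    (0 < m)%N ->
    (forall i k, (`|(numer (S i))@_k| <= 2 ^ h)%N /\ (`|(denom (S i))@_k| <= 2 ^ h)%N) ->
    (forall i, bounded 1 (x i)) ->
  let t := ((1 + m * (#|{: 'X_{1..m < d.+1}}| + (h + d))) ^ k)%N in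
  (forall i, bounded t ((orbit_frac d S x k).1 i)) /\ bounded t (orbit_frac d S x k).2.
Proof.
move=> m_gt0 hS bx; set E := (1 + _)%N; elim: k => [|k /= [IHA IHQ]] /=.
  by split=> //; apply: bounded1.
set t := (E ^ k)%N in IHA IHQ *; have t_gt0 : (0 < t)%N by rewrite expn_gt0.
set u := (#|{: 'X_{1..m < d.+1}}| + (h + d * t))%N.
have bN i : bounded u (homog_eval d (numer (S i)) (orbit_frac d S x k).1 (orbit_frac d S x k).2).
  by apply: bounded_homog_eval => // l; have [] := hS i l.
have bD i : bounded u (homog_eval d (denom (S i)) (orbit_frac d S x k).1 (orbit_frac d S x k).2).
  by apply: bounded_homog_eval => // l; have [] := hS i l.
have le : (t + m * u <= E ^ k.+1)%N.
  rewrite expnS -/t mulnDl mul1n leq_add2l -mulnA leq_mul2l; apply/orP; right.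
  by rewrite /u !mulnDl !leq_add // leq_pmulr.
split=> [i|]; apply: boundedW le _; apply: boundedM => //.
  have -> : (m * u = u + \sum_(j < m | j != i) u)%N.
    by rewrite -(bigD1 i (P := predT) (F := fun=> u)) //= sum_nat_const card_ord.
  by apply: boundedM => //; apply: bounded_prod.
rewrite -{1}(card_ord m) -sum_nat_const; exact: bounded_prod.
Qed.

End OrbitFrac.

(** * Windows of the orbit *)

Corollary arithmetic_nullstellensatz_fin n :
  exists k, forall a (I : finType) (F : I -> itpoly n),
    (2 <= a)%N -> (#|I| <= a)%N -> (forall i, bounded a (F i)) ->
    ~ (exists w : nat -> algC, forall i, ieval w n (F i) = 0) ->
  exists B : nat, [/\ (0 < B)%N, (B <= 2 ^ (a ^ k))%N &
    forall p, prime p -> ~~ (p %| B)%N ->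
      ~ exists w : nat -> Fpbar p, forall i, ieval w n (F i) = 0].
Proof.
have [k hk] := arithmetic_nullstellensatz n; exists k => a I F a_ge2 leI bF ncz.
pose f u := nth 0 (codom F) u.
have fE (i : I) : exists2 u, (u < #|I|)%N & f u = F i.
  exists (enum_rank i); first exact: ltn_ord.
  by rewrite /f /= (nth_map i) ?nth_enum_rank // -cardE ltn_ord.
have Ef u : (u < #|I|)%N -> exists i, f u = F i.
  move=> ltu; exists (enum_val (Ordinal ltu)).
  by rewrite /f (nth_map (enum_default (Ordinal ltu))) -?cardE.
have [|/= [w hw]|B [B_gt0 leB hB]] := hk a #|I| f a_ge2 leI.
- by move=> u /Ef[i ->].
- by apply: ncz; exists w => i; have [u ltu <-] := fE i; apply: hw.
exists B; split=> // p pp ndvd [w hw]; apply: (hB p pp ndvd); exists w => u.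
by move=> /Ef[i ->].
Qed.

Lemma orbit_at_add (K : fieldType) m (S : ratsystem m) (w u : {ffun 'I_m -> K}) a n :
  orbit_at S w a = Some u -> orbit_at S w (a + n) = orbit_at S u n.
Proof. by move=> wu; elim: n => [|n IHn]; rewrite ?addn0 // addnS /= IHn. Qed.

Lemma orbit_at_None (K : fieldType) m (S : ratsystem m) (w : {ffun 'I_m -> K}) a n :
  orbit_at S w a = None -> (a <= n)%N -> orbit_at S w n = None.
Proof.
move=> wa; elim: n => [|n IHn]; first by rewrite leqn0 => /eqP <-.
by rewrite leq_eqVlt => /predU1P[<- //|]; rewrite ltnS /= => /IHn ->.
Qed.

Lemma card_le_inj (T U : Type) (A : set T) (B : set U) (u0 : U) :
    (A #<= B)%card ->
  exists g : T -> U, (forall x, A x -> B (g x)) /\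
    forall x y, A x -> A y -> g x = g y -> x = y.
Proof.
move=> /card_leP/unsquash h.
pose g x := if pselect (A x) is left Ax then set_val (h (SigSub (mem_set Ax))) else u0.
exists g; split=> [x Ax|x y Ax Ay]; rewrite /g.
  by case: pselect => // Ax'; apply: set_mem; apply: valP.
case: pselect => // Ax'; case: pselect => // Ay' /val_inj.
by move=> /(@inj _ _ _ h); rewrite !inE => /(_ Logic.I Logic.I) [].
Qed.

Lemma card_le_uniq (T : eqType) (A : set T) (s : seq T) L :
  (A #<= `I_L)%card -> uniq s -> (forall x, x \in s -> A x) -> (size s <= L)%N.
Proof.
move=> /(card_le_inj 0%N)[g [gL gI]] us sA.
rewrite -(size_map g) -[X in (_ <= X)%N](size_iota 0 L); apply: uniq_leq_size.
  by rewrite map_inj_in_uniq // => x y /sA Ax /sA Ay; apply: gI.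
by move=> u /mapP[x /sA Ax ->]; rewrite mem_iota add0n; apply: gL.
Qed.

(** If the orbit stopped at time [n], its points of positive time would all occur at the times from
    1 to [n - 1], fewer than [N] in number. *)
Lemma orbit_at_defined (K : fieldType) m (S : ratsystem m) (w : {ffun 'I_m -> K}) N n :
    ((`I_N)%classic #<= orbit_points S w)%card -> (n < N)%N ->
  orbit_at S w n <> None.
Proof.
move=> /(card_le_inj w)[g [gO gI]] ltn wn.
pose s := [seq Some (g i) | i <- iota 0 N].
have : (size s <= size [seq orbit_at S w j | j <- iota 1 n.-1])%N.
  apply: uniq_leq_size.
    rewrite map_inj_in_uniq ?iota_uniq // => i j.
    by rewrite !mem_iota !add0n /= => lti ltj [/gI]; apply.
  move=> u /mapP[i + ->]; rewrite mem_iota add0n => /andP[_ lti].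
  have [j j_gt0 wj] := gO i lti; rewrite -wj.
  apply: map_f; rewrite mem_iota j_gt0 /= ltnNge; apply/negP => lenj.
  have : (n <= j)%N by lia.
  by move/(orbit_at_None wn); rewrite wj.
rewrite !size_map !size_iota; lia.
Qed.

(** [A] is chosen before the system and before [K], which is the source of the uniformity of the
    final constant. *)
Lemma uniform_modulus m s d D L h : (0 < m)%N ->
  exists A : nat, (0 < A)%N /\ forall (S : ratsystem m) (P : 'I_s -> {mpoly int[m]}),
    (forall i, (ratdegree (S i) <= d)%N) ->
    (forall i k, (`|(numer (S i))@_k| <= 2 ^ h)%N /\ (`|(denom (S i))@_k| <= 2 ^ h)%N) ->
    (forall j, (mdegree (P j) <= D)%N) ->
    (forall j k, (`|(P j)@_k| <= 2 ^ h)%N) ->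
    uniformly_bounded S P L ->
    forall K, (0 < K)%N -> exists B : nat, [/\ (0 < B)%N, (B <= 2 ^ (A ^ K))%N &
      forall p, prime p -> ~~ (p %| B)%N ->
      forall (w : {ffun 'I_m -> Fpbar p}) (sigma : {set 'I_K}),
        (forall n, n \in sigma ->
           exists2 v, orbit_at S w n = Some v & on_variety P v) ->
        (#|sigma| <= L)%N].
Proof.
move=> m_gt0; have [k hk] := arithmetic_nullstellensatz_fin m.+1.
(* [E] is the growth rate of [orbit_frac], [X] covers the substitution into the [P j], and [s]
   enters the number of equations. The factor 2 in [A0] absorbs [K <= 2 ^ K]. *)
pose E := (1 + m * (#|{: 'X_{1..m < d.+1}}| + (h + d)))%N.
pose X := (#|{: 'X_{1..m < D.+1}}| + h + D + 3)%N.
pose A0 := (2 * E * (X + s))%N.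
exists (2 * A0 ^ k)%N; split.
  by rewrite muln_gt0 expn_gt0 /A0 /X !muln_gt0 /= !addnS.
move=> S P degS hS degP hP unifL K K_gt0.
pose x i : itpoly m := ivar m i.
pose AQ n := orbit_frac d S (x : 'I_m -> itpoly m) n.
pose last (sigma : {set 'I_K}) := \max_(n in sigma) (n : nat).
(* The last equation is Rabinowitsch's trick: an extra variable, of index [m], inverts the
   denominator at the last visiting time, hence makes all earlier ones nonzero. Times outside
   [sigma] give the trivial equation 0. *)
pose F (sigma : {set 'I_K}) (u : option ('I_K * 'I_s)) : itpoly m.+1 :=
  if u is Some (n, j) then
    if n \in sigma then (homog_eval D (P j) (AQ n).1 (AQ n).2)%:P else 0
  else 1 - 'X * ((AQ (last sigma)).2)%:P.
have lastP (sigma : {set 'I_K}) n : n \in sigma -> (n <= last sigma)%N.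
  by move=> ns; apply: (leq_bigmax_cond (F := fun n : 'I_K => n : nat)).
have last_lt sigma : (last sigma <= K)%N.
  by apply/bigmax_leqP => n _; apply: ltnW.
(* A dictionary between zeros of the system and visiting times, used both over [algC] and over
   [Fpbar p]. *)
have zeroP (T : fieldType) sigma (w : nat -> T) (v := [ffun i : 'I_m => w i]) :
    (forall u, ieval w m.+1 (F sigma u) = 0) <->
    w m * (orbit_frac d S v (last sigma)).2 = 1 /\
    forall n, n \in sigma -> exists2 y, orbit_at S v n = Some y & on_variety P y.
  have xv : ieval w m \o (x : 'I_m -> itpoly m) = v.
    by apply: funext => i; rewrite ffunE; apply: ieval_var.
  have [evA evQ] : (forall n i, ieval w m ((AQ n).1 i) = (orbit_frac d S v n).1 i) /\
      (forall n, ieval w m (AQ n).2 = (orbit_frac d S v n).2).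
    by split=> n; have [eA eQ] := rmorph_orbit_frac d S (ieval w m) x n; rewrite -xv.
  have evC c : ieval w m.+1 (c%:P : {poly (itpoly m)}) = ieval w m c.
    by rewrite ievalS map_polyC hornerC.
  have evNone : ieval w m.+1 (F sigma None) = 1 - w m * (orbit_frac d S v (last sigma)).2.
    have evX : ieval w m.+1 ('X : {poly (itpoly m)}) = w m.
      by rewrite ievalS map_polyX hornerX.
    rewrite /F (rmorphB (ieval w m.+1)) (rmorphM (ieval w m.+1)).
    by rewrite (rmorph1 (ieval w m.+1)) evX evC evQ.
  have evSome n j : n \in sigma -> ieval w m.+1 (F sigma (Some (n, j))) =
      homog_eval D (P j) (orbit_frac d S v n).1 (orbit_frac d S v n).2.
    move=> ns; rewrite /F ns evC rmorph_homog_eval evQ; congr homog_eval.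
    by apply: funext => i; apply: evA.
  have var n : n \in sigma -> (orbit_frac d S v (last sigma)).2 != 0 ->
      (exists2 y, orbit_at S v n = Some y & on_variety P y) <->
      forall j, homog_eval D (P j) (orbit_frac d S v n).1 (orbit_frac d S v n).2 = 0.
    move=> ns nzl; have nzn := den_le (lastP _ _ ns) nzl.
    rewrite (orbit_at_frac degS n (fun i => erefl)) nzn.
    set y := finfun _; have -> : (exists2 z, Some y = Some z & on_variety P z) <-> on_variety P y.
      by split=> [[z [<-]]|]; last by exists y.
    have -> : (y : 'I_m -> T) = fun i => (orbit_frac d S v n).1 i / (orbit_frac d S v n).2.
      by apply: funext => i; rewrite ffunE.
    rewrite (on_variety_frac degP nzn); split=> [/forallP h0 j|h0]; first exact/eqP.
    by apply/forallP => j; apply/eqP.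
  split=> [F0|[wQ hs] u].
    have wQ : w m * (orbit_frac d S v (last sigma)).2 = 1.
      by apply/esym/eqP; rewrite -subr_eq0 -evNone F0.
    split=> // n ns; apply/var => // [|j]; last by rewrite -evSome.
    by apply: contraTneq (oner_neq0 T) => Q0; rewrite -wQ Q0 mulr0 eqxx.
  case: u => [[n j]|]; last by rewrite evNone wQ subrr.
  have [ns|nns] := boolP (n \in sigma); last by rewrite /F (negPf nns) rmorph0.
  rewrite evSome //; apply/(var n ns): j; last exact: hs.
  by apply: contraTneq (oner_neq0 T) => Q0; rewrite -wQ Q0 mulr0 eqxx.
have E_gt0 : (0 < E)%N by [].
have leA0 : (E ^ K * X <= A0 ^ K)%N /\ ((K * s).+1 <= A0 ^ K)%N.
  have leXs : (X + s <= (X + s) ^ K)%N.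
    by rewrite -{1}[(X + s)%N]expn1 leq_pexp2l // /X addnS.
  have EK : (0 < E ^ K)%N by rewrite expn_gt0.
  have lt2 := ltn_expl K (leqnn 2).
  rewrite /A0 !expnMn; split.
    rewrite [(2 ^ K * _)%N]mulnC -mulnA leq_mul2l; apply/orP; right.
    apply: (@leq_trans (X + s)); first exact: leq_addr.
    by apply: leq_trans leXs _; rewrite leq_pmull // expn_gt0.
  apply: (@leq_trans (2 ^ K * (X + s))%N); last first.
    by rewrite -mulnA leq_mul2l; apply/orP; right; apply: leq_trans leXs _; rewrite leq_pmull.
  rewrite mulnDr -addn1 addnC leq_add //; first by rewrite muln_gt0 expn_gt0 /X addnS.
  by rewrite leq_mul2r (ltnW lt2) orbT.
have A0_ge2 : (2 <= A0 ^ K)%N.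
  apply: leq_trans leA0.1; apply: (@leq_trans X); first by rewrite /X !addnS.
  by rewrite leq_pmull // expn_gt0.
have bndF sigma u : bounded (A0 ^ K) (F sigma u).
  apply: boundedW leA0.1 _.
  have bAQ n : (n <= K)%N -> (forall i, bounded (E ^ K) ((AQ n).1 i)) /\ bounded (E ^ K) (AQ n).2.
    move=> lenK; have [bA bQ] := @bounded_orbit_frac m d S h m n x m_gt0 hS (fun i : 'I_m => bounded_var m i).
    by split=> [i|]; [move: (bA i) | move: bQ]; apply: boundedW; rewrite leq_pexp2l.
  set t := (E ^ K)%N in bAQ *; have t_gt0 : (0 < t)%N by rewrite expn_gt0.
  case: u => [[n j]|] /=.
    case: ifP => _; last exact: (@bounded0 m.+1).
    have [bA bQ] := bAQ n (ltnW (ltn_ord n)).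
    apply: boundedC; apply: boundedW (bounded_homog_eval D (hP j) bA bQ).
    rewrite /X; nia.
  have [_ bQ] := bAQ _ (last_lt sigma).
  apply: (@boundedW m.+1 (1 + t).+1); first by rewrite /X; nia.
  apply: (@boundedD m.+1); first exact: (@bounded1 m.+1).
  apply: (@boundedN m.+1); apply: (@boundedM m.+1 1 t); last exact: boundedC.
  exact: (@bounded_polyXn m 1).
have cardI : (#|{: option ('I_K * 'I_s)}| <= A0 ^ K)%N.
  by rewrite card_option card_prod !card_ord leA0.2.
(* Sets with at most [L] elements get the modulus 1; for the others a zero over [algC] would give an
   orbit with more than [L] visits. *)
have exB (sigma : {set 'I_K}) : exists B : nat, [/\ (0 < B)%N, (B <= 2 ^ ((A0 ^ K) ^ k))%N &
    (L < #|sigma|)%N -> forall p, prime p -> ~~ (p %| B)%N ->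
    ~ exists w : nat -> Fpbar p, forall u, ieval w m.+1 (F sigma u) = 0].
  have [ltL|] := boolP (L < #|sigma|)%N; last by exists 1%N; rewrite expn_gt0.
  have [|B [B_gt0 leB hB]] := hk _ _ (F sigma) A0_ge2 cardI (bndF sigma); last by exists B.
  case=> w /zeroP[_ hs].
  suff : (size [seq nat_of_ord n | n in sigma] <= L)%N.
    by rewrite size_map -cardE leqNgt ltL.
  apply: (card_le_uniq (unifL [ffun i : 'I_m => w i])).
    by rewrite map_inj_uniq ?enum_uniq //; apply: val_inj.
  by move=> u /mapP[n + ->]; rewrite mem_enum => /hs.
have [Bs hBs] := choice exB.
(* With $2^K$ factors the exponent becomes $2^K A_0^{kK} = (2A_0^k)^K$. *)
exists (\prod_sigma Bs sigma)%N; split.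
- by apply: prodn_gt0 => sigma; have [] := hBs sigma.
- apply: (@leq_trans (\prod_(sigma : {set 'I_K}) 2 ^ ((A0 ^ K) ^ k))%N).
    by apply: leq_prod => sigma _; have [] := hBs sigma.
  rewrite prod_nat_const -expnM leq_exp2l //.
  rewrite -[#|_|]cardsT -powersetT card_powerset cardsT card_ord.
  by rewrite expnMn -!expnM mulnC (mulnC k).
move=> p pp ndvd w sigma hs; rewrite leqNgt; apply/negP => ltL.
have [_ _ /(_ ltL p pp)] := hBs sigma; apply.
  by apply: contra ndvd => dv; rewrite (bigD1 sigma) //= dvdn_mulr.
pose Q := (orbit_frac d S w (last sigma)).2.
pose w' (i : nat) := if insub i is Some j then w j else Q^-1.
have w'E : [ffun i : 'I_m => w' i] = w.
  by apply/ffunP => i; rewrite ffunE /w' valK.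
exists w'; apply/zeroP; rewrite w'E; split=> //.
rewrite {1}/w' insubN ?ltnn // mulVf //.
(* [sigma] is nonempty, so its maximal time belongs to it; the orbit is defined there and [Q] is
   nonzero. *)
have [n0 n0s] : exists n, n \in sigma by apply/set0Pn; rewrite -card_gt0 (leq_ltn_trans _ ltL).
have [n ns Elast] := eq_bigmax_cond (fun n : 'I_K => n : nat) (leq_ltn_trans (leq0n _) ltL).
have [v + _] := hs n ns; rewrite /Q /last Elast.
by rewrite (orbit_at_frac degS n (fun i => erefl)); case: ifP.
Qed.

(** * Real heights, counting by blocks and the density estimate *)

Lemma mheight_coef (R : realType) m (F : {mpoly int[m]}) (h : R) (h' : nat) :
  mheight R F <= h -> (Num.truncn (expR h) < h')%N ->
  forall k, (`|F@_k| <= 2 ^ h')%N.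
Proof.
rewrite /mheight; set M := \max_(k <- msupp F) _ => leM lth k.
have [kF|/memN_msupp_eq0->] := boolP (k \in msupp F); last by rewrite absz0.
have FkM : (`|F@_k| <= M)%N.
  exact: (leq_bigmax_seq (F := fun k => `|F@_k|%N) (P := predT)).
have M_gt0 : (0 < M)%N.
  by apply: leq_trans FkM; rewrite absz_gt0 -mcoeff_msupp.
have MR : M%:R <= expR h by rewrite -[M%:R]exp.lnK ?exp.ler_expR // posrE ltr0n.
(* The exponent [h'] is taken above the maximal coefficient itself, not its logarithm, and
   [h' <= 2 ^ h']. *)
apply: leq_trans FkM (leq_trans _ (ltnW (ltn_expl h' (leqnn 2)))).
by apply: leq_trans (ltnW lth); rewrite Num.Theory.truncn_ge_nat // exp.expR_ge0.
Qed.

(** The times below [N] fall into at most [N %/ k + 1] blocks of length [k]. Counted from the start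
    of its block, a visit is a visit of the orbit of the point [u] reached there, so a block
    contains at most [L] of them. *)
Lemma card_visits_le (K : fieldType) m s d L (S : ratsystem m)
    (P : 'I_s -> {mpoly int[m]}) N k (w : {ffun 'I_m -> K}) :
    (0 < k)%N -> (forall i, (ratdegree (S i) <= d)%N) ->
    (forall n, (n < N)%N -> orbit_at S w n <> None) ->
    (forall (u : {ffun 'I_m -> K}) (sigma : {set 'I_k}),
       (forall n, n \in sigma ->
          exists2 v, orbit_at S u n = Some v & on_variety P v) ->
       (#|sigma| <= L)%N) ->
  (#|visits S P N w| <= L * (N %/ k).+1)%N.
Proof.
move=> k_gt0 degS defw hL; set V := visits S P N w.
pose b (n : 'I_N) : 'I_(N %/ k).+1 := inord (n %/ k).
have bE n : b n = (n %/ k)%N :> nat.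
  by rewrite inordK // ltnS leq_div2r // ltnW.
rewrite -sum1_card (partition_big b predT) //=.
apply: (@leq_trans (\sum_(j < (N %/ k).+1) L)); last by rewrite sum_nat_const card_ord mulnC.
apply: leq_sum => j _; rewrite sum1dep_card.
set A := finset _; have [->|[n0 n0A]] := set_0Vmem A; first by rewrite cards0.
pose r (n : 'I_N) : 'I_k := Ordinal (ltn_pmod n k_gt0).
have nE n : n \in A -> n = (j * k + r n)%N :> nat.
  by rewrite inE => /andP[_ /eqP <-]; rewrite bE /= -divn_eq.
have rinj : {in A &, injective r}.
  by move=> n n' /nE En /nE En' rn; apply: val_inj; rewrite /= En En' rn.
rewrite -(card_in_imset rinj).
have ltj : (j * k < N)%N.
  apply: leq_ltn_trans (ltn_ord n0).
  by rewrite [X in (_ <= X)%N](nE _ n0A) leq_addr.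
case Eu : (orbit_at S w (j * k)) (defw _ ltj) => [u|] // _.
apply: (hL u) => _ /imsetP[n nA ->].
case Ev : (orbit_at S w n) (defw _ (ltn_ord n)) => [v|] // _; exists v.
  by rewrite -(orbit_at_add _ Eu) -nE.
(* [visits] is phrased with reduced iterates; [iterate_orbit] identifies their values with orbit
   points. *)
move: nA; rewrite inE => /andP[]; rewrite inE => /and3P[_ np on] _.
by rewrite -(iterate_orbit degS Ev np).
Qed.

Theorem theorem6p2 (R : realType) (m s d D L : nat) (h H : R)
    (hm : (2 <= m)%N) (hd : (2 <= d)%N) :
  exists c : R, 0 < c /\
    forall (S : ratsystem m) (P : 'I_s -> {mpoly int[m]}),
      (forall i, (ratdegree (S i) <= d)%N) ->
      (forall i, ratheight R (S i) <= h) ->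
      (forall j, (mdegree (P j) <= D)%N) ->
      (forall j, mheight R (P j) <= H) ->
      uniformly_bounded S P L ->
      forall eps : R, 0 < eps ->
        exists B : nat, (0 < B)%N /\ ln B%:R <= expR (c / eps) /\
          forall p : nat, prime p -> ~~ (p %| B)%N ->
          forall N : nat, 2 * L%:R / eps + 1 <= N%:R ->
          forall w : {ffun 'I_m -> Fpbar p},
            ((`I_N)%classic #<= orbit_points S w)%card ->
            #|visits S P N w|%:R / N%:R <= eps.
Proof.
pose h' := (maxn (Num.truncn (expR h)) (Num.truncn (expR H))).+1.
have [A [A_gt0 hA]] := @uniform_modulus m s d D L h' (ltnW hm).
have A_ge1 : 1 <= A%:R :> R by rewrite ler1n.
have lnA : 0 <= ln A%:R :> R by apply: exp.ln_ge0.
(* From [K * eps <= 2 * L + 1] will follow [K * ln A <= c / eps]; the final 1 keeps [c] positive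
   when [A] is 1. *)
pose c : R := (2 * L%:R + 1) * ln A%:R + 1.
have L_ge0 : 0 <= L%:R :> R by [].
have c_gt0 : 0 < c by rewrite ltr_wpDl // mulr_ge0 // addr_ge0 // mulr_ge0.
exists c; split=> // S P degS hS degP hP unifL eps eps_gt0.
have N_gt0 N : 2 * L%:R / eps + 1 <= N%:R -> 0 < N%:R :> R.
  by apply: lt_le_trans; rewrite ltr_wpDl // divr_ge0 ?mulr_ge0 // ltW.
(* For [1 <= eps] the trivial bound by [N] suffices; [eps < 1] serves to bound [K * eps]. *)
have [eps_ge1|eps_lt1] := leP 1 eps.
  exists 1%N; split=> //; split; first by rewrite exp.ln1 exp.expR_ge0.
  move=> p _ _ N /N_gt0 N0 w _; apply: le_trans eps_ge1.
  rewrite ler_pdivrMr // mul1r ler_nat.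
  by rewrite (leq_trans (max_card _)) // card_ord.
(* The window length exceeds [2 * L / eps], by at most 1. *)
pose K := (Num.truncn (2 * L%:R / eps)).+1.
have q_ge0 : 0 <= 2 * L%:R / eps by rewrite divr_ge0 ?mulr_ge0 // ltW.
have /andP[leK ltK] := Num.Theory.truncn_itv q_ge0; rewrite -/K in ltK.
have cS i k : (`|(numer (S i))@_k| <= 2 ^ h')%N /\ (`|(denom (S i))@_k| <= 2 ^ h')%N.
  have := hS i; rewrite /ratheight ge_max => /andP[hn hdn].
  by split; [apply: mheight_coef hn _ _ | apply: mheight_coef hdn _ _]; rewrite ltnS leq_maxl.
have cP j k : (`|(P j)@_k| <= 2 ^ h')%N.
  by apply: mheight_coef (hP j) _ _; rewrite ltnS leq_maxr.
have [B [B_gt0 leB hB]] := hA S P degS cS degP cP unifL K isT.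
exists B; split=> //; split.
  (* The chain is [ln B <= ln 2 * A ^ K <= A ^ K = expR (K * ln A)]. *)
  apply: (@le_trans _ _ (ln (2 ^ (A ^ K))%:R)).
    by rewrite exp.ler_ln ?posrE ?ltr0n ?expn_gt0 // ler_nat.
  have -> : ln (2 ^ (A ^ K))%:R = (ln 2%:R) * (A ^ K)%:R :> R.
    by rewrite natrX exp.lnXn ?mulr_natr.
  have ln2 : ln 2%:R <= 1 :> R.
    have -> : 2%:R = 1 + 1 :> R by rewrite -mulr2n.
    by apply: exp.le_ln1Dx; rewrite (lt_le_trans _ ler01) // ltrN10.
  apply: (@le_trans _ _ (A ^ K)%:R); first by rewrite ler_piMl.
  have -> : (A ^ K)%:R = expR (K%:R * ln A%:R) :> R.
    by rewrite exp.expRM_natl exp.lnK ?natrX // posrE ltr0n.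
  rewrite exp.ler_expR ler_pdivlMr // /c.
  have Keps : K%:R * eps <= 2 * L%:R + 1.
    have : (Num.truncn (2 * L%:R / eps))%:R * eps <= 2 * L%:R.
      by rewrite -ler_pdivlMr.
    rewrite /K -natr1 mulrDl mul1r => le; lra.
  rewrite mulrAC; have := ler_wpM2r lnA Keps; lra.
move=> p pp ndvd N leN w orbw.
have N0 := N_gt0 _ leN; rewrite ler_pdivrMr //.
have cnt := @card_visits_le (Fpbar p) m s d L S P N K w isT degS
  (fun n => orbit_at_defined orbw) (hB p pp ndvd).
apply: (@le_trans _ _ (L * (N %/ K).+1)%:R); first by rewrite ler_nat.
(* Both summands, [L * (N %/ K)] and [L], are at most [eps * N / 2]: the first by the choice of [K],
   the second by the lower bound on [N]. *)
rewrite natrM -natr1 mulrDr mulr1.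
have K_gt0 : 0 < K%:R :> R by rewrite ltr0n.
have le1 : (N %/ K)%:R * K%:R <= N%:R :> R by rewrite -natrM ler_nat leq_divM.
have le2 : 2 * L%:R <= K%:R * eps by rewrite -ler_pdivrMr // ltW.
have le3 : 2 * L%:R <= N%:R * eps.
  by rewrite -ler_pdivrMr // (le_trans _ leN) // lerDl.
have le4 : 2 * L%:R * (N %/ K)%:R <= eps * N%:R.
  apply: (@le_trans _ _ (K%:R * eps * (N %/ K)%:R)); first by rewrite ler_wpM2r.
  by have := ler_wpM2r (ltW eps_gt0) le1; lra.
lra.
Qed.
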